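(* Let $K$ be a wall in $\{0\le x_1\le M\}$. Suppose there is a continuous curve $\gamma$ joining a point $P_1\in\{x_1<0\}$ to a point $P_2\in\{x_1>M\}$ such that every point of $\gamma$ has distance at least $R_0$ from $K$. Then propagation occurs: $\bar v(x_1,y)\to1$ as $x_1\to+\infty$.
   Context: Standing setting: $N\ge2$, $x=(x_1,y)$, $y\in\mathbb R^{N-1}$. $f\in C^1(\mathbb R)$ is bistable: for some $\alpha\in(0,1)$, $f(0)=f(\alpha)=f(1)=0$, $f'(0)<0$, $f'(\alpha)>0$, $f'(1)<0$, $f<0$ on $(0,\alpha)$, $f>0$ on $(\alpha,1)$, $\int_0^1f>0$. Let $c>0$, $\phi$ be the unique traveling wave: $\phi''+c\phi'+f(\phi)=0$, $0<\phi<1$, $\phi(-\infty)=1$, $\phi(+\infty)=0$, $\phi(0)=\alpha$. A wall is a closed set $K\subset\{0\le x_1\le M\}$ (some $M>0$) with uniformly smooth boundary such that $\Omega:=\mathbb R^N\setminus K$ is connected. $\bar u$ is the unique entire solution of $u_t=\Delta u+f(u)$ in $\Omega$, $\partial_\nu u=0$ on $\partial\Omega$, with $0<\bar u<1$ and $\sup_{x\in\Omega}|\bar u(t,x)-\phi(x_1-ct)|\to0$ as $t\to-\infty$; the limit profile is $\bar v:=\lim_{t\to+\infty}\bar u(t,\cdot)$. $R_0:=\min\{R>0:\ \text{the problem }\Delta\Psi+f(\Psi)=0\text{ in }|x|<R,\ \Psi=0\text{ on }|x|=R,\ 0<\Psi<1\text{ in }|x|<R\text{ has a solution}\}$ (this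 minimum exists). *)

(* Defs.v *)
From HB Require Import structures.
From mathcomp Require Import all_boot all_order all_algebra.
From mathcomp Require Import all_classical all_reals all_analysis.
Set Implicit Arguments. Unset Strict Implicit. Unset Printing Implicit Defensive.
Import Order.TTheory GRing.Theory Num.Theory.
Import numFieldNormedType.Exports.
Local Open Scope classical_set_scope.
Local Open Scope ring_scope.

Section Geometry.
Variables (R : realType) (n : nat).
Local Notation V := 'rV[R]_(n.+1).

Definition x1 (x : V) : R := x ord0 ord0.

Definition evec (i : 'I_n.+1) : V := delta_mx ord0 i.

Definition enorm (x : V) : R := Num.sqrt (\sum_i (x ord0 i) ^+ 2).
Definition dotv (a b : V) : R := \sum_i a ord0 i * b ord0 i.

Definition pd (i : 'I_n.+1) (F : V -> R) (x : V) : R := 'D_(evec i) F x.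
Definition grad (F : V -> R) (x : V) : V := \row_i pd i F x.
Definition laplacian (F : V -> R) (x : V) : R := \sum_i pd i (pd i F) x.

Fixpoint itd (l : seq 'I_n.+1) (F : V -> R) : V -> R :=
  match l with [::] => F | i :: l' => pd i (itd l' F) end.

Definition unif_smooth (F : V -> R) : Prop :=
  forall l : seq 'I_n.+1,
    (forall i x, derivable (itd l F) x (evec i)) /\
    continuous (itd l F) /\
    exists C : R, forall x, `|itd l F x| <= C.

Definition C2_at (F : V -> R) (x : V) : Prop :=
  forall i, derivable F x (evec i) /\ pd i F @ x --> pd i F x /\
    forall j, derivable (pd i F) x (evec j) /\
              pd j (pd i F) @ x --> pd j (pd i F) x.

(* A wall in {0 <= x_1 <= M}, with uniformly smooth boundary described by a
   uniformly smooth defining function rho : K = {rho <= 0}, and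
   |grad rho| >= delta > 0 on {rho = 0} = boundary of K. *)
Definition wall (M : R) (K : set V) (rho : V -> R) : Prop :=
  0 < M /\ closed K /\ (forall x, K x -> 0 <= x1 x <= M) /\
  connected (~` K) /\
  unif_smooth rho /\ K = [set x | rho x <= 0] /\
  exists delta : R, 0 < delta /\ forall x, rho x = 0 -> delta <= enorm (grad rho x).

(* Classical (C^{1,2}) entire solution of u_t = Lap u + f(u) in R x Omega,
   Omega = R^N \ K, continuous with continuous gradient up to the boundary,
   with homogeneous Neumann condition on the boundary (the normal to the
   boundary at p is parallel to grad rho p). *)
Definition entire_solution (f : R -> R) (K : set V) (rho : V -> R)
  (u : R -> V -> R) : Prop :=
  let Om := ~` K in
  (forall t x, Om x ->
     derivable (fun s => u s x) t 1 /\
     (fun p : R * V => 'D_1 (fun s => u s p.2) p.1) @ (t, x) -->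
        'D_1 (fun s => u s x) t /\
     forall i, derivable (u t) x (evec i) /\
       (fun p : R * V => pd i (u p.1) p.2) @ (t, x) --> pd i (u t) x /\
       forall j, derivable (pd i (u t)) x (evec j) /\
         (fun p : R * V => pd j (pd i (u p.1)) p.2) @ (t, x) -->
            pd j (pd i (u t)) x) /\
  {within [set p : R * V | closure Om p.2], continuous (fun p => u p.1 p.2)} /\
  (exists g : R -> V -> V,
     {within [set p : R * V | closure Om p.2], continuous (fun p => g p.1 p.2)} /\
     (forall t x, Om x -> g t x = grad (u t) x) /\
     (forall t p, closure Om p -> ~ Om p -> dotv (g t p) (grad rho p) = 0)) /\
  (forall t x, Om x -> 'D_1 (fun s => u s x) t = laplacian (u t) x + f (u t x)).

Definition ball_solvable (f : R -> R) (r : R) : Prop :=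
  exists Psi : V -> R,
    (forall x, enorm x < r ->
       C2_at Psi x /\ laplacian Psi x + f (Psi x) = 0 /\ 0 < Psi x < 1) /\
    (forall x, enorm x = r -> Psi x = 0) /\
    {within [set x | enorm x <= r], continuous Psi}.

Definition is_R0 (f : R -> R) (R0 : R) : Prop :=
  (0 < R0 /\ ball_solvable f R0) /\
  forall r, 0 < r -> ball_solvable f r -> R0 <= r.

End Geometry.

Section OneDim.
Variable R : realType.

Definition bistable (f : R -> R) (alpha : R) : Prop :=
  (forall x, derivable f x 1) /\ continuous ((derive1 f)) /\
  0 < alpha < 1 /\ f 0 = 0 /\ f alpha = 0 /\ f 1 = 0 /\
  (derive1 f) 0 < 0 /\ 0 < (derive1 f) alpha /\ (derive1 f) 1 < 0 /\
  (forall x, 0 < x < alpha -> f x < 0) /\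
  (forall x, alpha < x < 1 -> 0 < f x) /\
  (0 < \int[lebesgue_measure]_(x in `[0%R, 1%R]) (f x)%:E)%E.

Definition traveling_wave (f : R -> R) (alpha c : R) (phi : R -> R) : Prop :=
  (forall x, derivable phi x 1) /\ (forall x, derivable ((derive1 phi)) x 1) /\
  (forall x, derive1n 2 phi x + c * (derive1 phi) x + f (phi x) = 0) /\
  (forall x, 0 < phi x < 1) /\
  phi x @[x --> -oo] --> (1:R) /\ phi x @[x --> +oo] --> (0:R) /\
  phi 0 = alpha.
End OneDim.

(* Main.v *)
(* Let w(x) be the half-relaxed lower limit of u(t,y) as t -> +oo, y -> x.  It is a
   lower semicontinuous viscosity supersolution of  Lap w + f(w) = 0  in Omega, and
   w <= v, so it suffices to show w -> 1.  A profile Psi of the ball problem, centred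
   far to the left, lies below u at a very negative time and hence below w.  The set
   of centres z, with B(z,R0) in Omega, such that w >= Psi(. - z) is closed, and open:
   by the strong maximum principle w cannot touch Psi(. - z) inside the ball, and on
   the thin shell near the sphere the minimum principle applies.  The profile
   therefore slides along gamma and then everywhere in {x_1 > M + R0}, which gives
   w >= max Psi > alpha on a half-space; since f > 0 on (alpha,1), quadratic test
   functions on large balls push w up to 1. *)

Require Import Defs.
From HB Require Import structures.
From mathcomp Require Import all_boot all_order all_algebra.
From mathcomp Require Import all_classical all_reals all_analysis.
From mathcomp Require Import ring lra.
Import Order.TTheory GRing.Theory Num.Theory.
Import numFieldNormedType.Exports.
Local Open Scope classical_set_scope.
Local Open Scope ring_scope.
Set Implicit Arguments.
Unset Strict Implicit.
Unset Printing Implicit Defensive.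

(** The half-relaxed limit stands in for parabolic estimates: it is lower semicontinuous by
    construction, and a minimum of [u] minus a test function at a late time transfers the equation
    to it. Only one-sided information on [w] is ever used. The obstacle is that the curve may run at
    distance exactly [R0] from the wall. All comparisons take place in open balls, and near the
    sphere they rely only on [Psi] tending to 0 and [w] being nonnegative. For the same reason
    strict separation from the profile needs a point of the sphere that lies inside the domain; a
    neighbouring admissible centre provides one. *)

Lemma cvgr_sum {R : realType} {T : Type} {F : set_system T} {FF : Filter F}
    {I : Type} (r : seq I) (f : I -> T -> R) (l : I -> R) :
  (forall i, f i @ F --> l i) ->
  (fun x => \sum_(i <- r) f i x) @ F --> \sum_(i <- r) l i.
Proof.
move=> fl; elim: r => [|i r ih].
  by rewrite big_nil; under eq_fun do rewrite big_nil; exact: cvg_cst.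
by rewrite big_cons; under eq_fun do rewrite big_cons; exact: cvgD.
Qed.

(** * Euclidean norm and the topology it induces *)

Section EuclideanNorm.
Context {R : realType} {n : nat}.
Local Notation V := 'rV[R]_(n.+1).
Implicit Types x y z a : V.

Definition sqnorm x : R := \sum_i (x ord0 i) ^+ 2.

Lemma sqnorm_ge0 x : 0 <= sqnorm x.
Proof. by apply: sumr_ge0 => i _; exact: sqr_ge0. Qed.

Lemma enorm_sqr x : enorm x ^+ 2 = sqnorm x.
Proof. by rewrite sqr_sqrtr // sqnorm_ge0. Qed.

Lemma enorm_ge0 x : 0 <= enorm x.
Proof. exact: sqrtr_ge0. Qed.

Lemma enorm0 : enorm (0 : V) = 0.
Proof.
by rewrite /enorm big1 ?sqrtr0// => i _; rewrite mxE expr0n.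
Qed.

Lemma sqnorm0 : sqnorm 0 = 0.
Proof. by rewrite -enorm_sqr enorm0 expr0n. Qed.

Lemma enormN x : enorm (- x) = enorm x.
Proof. by congr Num.sqrt; apply: eq_bigr => i _; rewrite mxE sqrrN. Qed.

Lemma enormB x y : enorm (x - y) = enorm (y - x).
Proof. by rewrite -enormN opprB. Qed.

Lemma enormZ k x : enorm (k *: x) = `|k| * enorm x.
Proof.
rewrite /enorm -sqrtr_sqr -sqrtrM ?sqr_ge0//; congr Num.sqrt.
by rewrite mulr_sumr; apply: eq_bigr => i _; rewrite mxE exprMn.
Qed.

Lemma coord_le_enorm x i : `|x ord0 i| <= enorm x.
Proof.
rewrite -sqrtr_sqr ler_wsqrtr//.
by rewrite (bigD1 i)//= lerDl sumr_ge0// => j _; exact: sqr_ge0.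
Qed.

Lemma enorm_eq0 x : enorm x = 0 -> x = 0.
Proof.
move=> x0; apply/rowP => i; rewrite mxE; apply/eqP.
by rewrite -normr_le0 -x0 coord_le_enorm.
Qed.

(** Cauchy-Schwarz: expand the squared norm of $|y|x-|x|y$ and divide by $2|x||y|$. *)
Lemma dotv_le x y : dotv x y <= enorm x * enorm y.
Proof.
have [/eqP/enorm_eq0 ->|x0] := boolP (enorm x == 0).
  by rewrite enorm0 mul0r /dotv big1// => i _; rewrite mxE mul0r.
have [/eqP/enorm_eq0 ->|y0] := boolP (enorm y == 0).
  by rewrite enorm0 mulr0 /dotv big1// => i _; rewrite mxE mulr0.
have xp : 0 < enorm x by rewrite lt0r x0 enorm_ge0.
have yp : 0 < enorm y by rewrite lt0r y0 enorm_ge0.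
have : 0 <= \sum_i (enorm y * x ord0 i - enorm x * y ord0 i) ^+ 2.
  by apply: sumr_ge0 => i _; exact: sqr_ge0.
have -> : \sum_i (enorm y * x ord0 i - enorm x * y ord0 i) ^+ 2 =
   enorm y ^+ 2 * sqnorm x - 2 * (enorm x * enorm y) * dotv x y +
   enorm x ^+ 2 * sqnorm y.
  rewrite /sqnorm /dotv !mulr_sumr -sumrB -big_split/=.
  by apply: eq_bigr => i _; ring.
rewrite -!enorm_sqr.
move: (mulr_gt0 xp yp) (dotv x y) => p d h.
have : 0 <= 2 * (enorm x * enorm y) * (enorm x * enorm y - d).
  by apply: le_trans h _; rewrite le_eqVlt; apply/orP; left; apply/eqP; ring.
by rewrite pmulr_rge0 ?subr_ge0// mulr_gt0.
Qed.

Lemma enormD x y : enorm (x + y) <= enorm x + enorm y.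
Proof.
rewrite -(@ler_pXn2r _ 2%N)// ?nnegrE ?addr_ge0 ?enorm_ge0//.
rewrite sqrrD !enorm_sqr.
have -> : sqnorm (x + y) = sqnorm x + dotv x y *+ 2 + sqnorm y.
  rewrite /sqnorm /dotv -sumrMnl -!big_split/=.
  by apply: eq_bigr => i _; rewrite mxE sqrrD.
by rewrite lerD2r lerD2l lerMn2r dotv_le orbT.
Qed.

Lemma enorm_triangle z x y : enorm (x - y) <= enorm (x - z) + enorm (z - y).
Proof. by have := enormD (x - z) (z - y); rewrite addrA subrK. Qed.

Lemma enorm_evec (i : 'I_n.+1) : enorm (evec R i) = 1.
Proof.
rewrite /enorm (bigD1 i)//= big1 => [|j ji]; last first.
  by rewrite mxE (negbTE ji) andbF expr0n.
by rewrite mxE !eqxx expr1n addr0 sqrtr1.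
Qed.

Lemma continuous_sqnorm : continuous sqnorm.
Proof.
move=> x; apply: (cvgr_sum (F := nbhs x) (f := fun i (y : V) => y ord0 i ^+ 2)) => i.
have ci : {for x, continuous (fun y : V => y ord0 i)} by exact: coord_continuous.
exact: (continuousM ci ci).
Qed.

Lemma continuous_enorm : continuous (@enorm R n).
Proof.
move=> x; apply: (@continuous_comp _ _ _ sqnorm Num.sqrt);
  [exact: continuous_sqnorm | exact: sqrt_continuous].
Qed.

Lemma continuous_subr (F : V -> R) a :
  continuous F -> continuous (fun x => F (x - a)).
Proof.
move=> cF x; apply: (@continuous_comp _ _ _ (fun y : V => y - a) F); last exact: cF.
have ci : {for x, continuous (fun y : V => y)} by move=> P.
exact: (continuousB ci (@cst_continuous _ _ a x)).
Qed.

Lemma continuous_dist a : continuous (fun x => enorm (x - a)).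
Proof. exact: continuous_subr continuous_enorm. Qed.

(** The topology of row vectors comes from the sup norm. One direction is [coord_le_enorm], the
    other is continuity of the Euclidean distance. *)
Lemma nbhs_enormP x (P : set V) :
  nbhs x P <-> exists2 e : R, 0 < e & forall y, enorm (y - x) < e -> P y.
Proof.
split.
  move/nbhs_ballP => [e /= e0 eP]; exists e => // y ye; apply: eP; split=> // i j.
  rewrite /ball/= (ord1 i) distrC; apply: le_lt_trans ye.
  by have := coord_le_enorm (y - x) j; rewrite !mxE.
move=> [e e0 eP].
have /cvgrPdist_lt /(_ _ e0) := @continuous_dist x x.
apply: filterS => y /=.
by rewrite subrr enorm0 sub0r normrN ger0_norm ?enorm_ge0//; exact: eP.
Qed.

Lemma near_enorm x e : 0 < e -> \forall y \near x, enorm (y - x) < e.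
Proof. by move=> e0; apply/nbhs_enormP; exists e. Qed.

Lemma compact_eball a r : compact [set x | enorm (x - a) <= r].
Proof.
apply: bounded_closed_compact; last first.
  apply: (@closed_comp _ _ (fun x => enorm (x - a)) [set y | y <= r]).
    by move=> x _; exact: continuous_dist.
  exact: closed_le.
exists (r + enorm a); split; first exact: num_real.
move=> M rM x /= xr.
have xb : enorm x <= r + enorm a.
  by have := enormD (x - a) a; rewrite subrK => /le_trans; apply; rewrite lerD2r.
have M0 : 0 <= M.
  by apply: le_trans (ltW rM); apply: le_trans xb; exact: enorm_ge0.
rewrite /Num.norm/= mx_normrE.
apply: bigmax_le => // -[i j] _ /=; rewrite (ord1 i).
by apply: le_trans (coord_le_enorm _ _) _; apply: le_trans xb _; exact: ltW.
Qed.

Lemma continuousP_enorm (F : V -> R) x :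
  {for x, continuous F} <-> forall e, 0 < e -> exists2 d, 0 < d &
    forall y, enorm (y - x) < d -> `|F y - F x| < e.
Proof.
split=> [/cvgrPdist_lt cF e e0|h].
  have /nbhs_enormP[d d0 dP] := cF _ e0.
  by exists d => // y /dP; rewrite distrC.
apply/(@cvgrPdist_lt _ _ _ (nbhs x)) => e e0; have [d d0 dP] := h _ e0.
by apply/nbhs_enormP; exists d => // y /dP; rewrite distrC.
Qed.

Lemma dist_evec x h i : enorm (x + h *: evec R i - x) = `|h|.
Proof. by rewrite addrC addKr enormZ enorm_evec mulr1. Qed.

Lemma x1_le_enorm x : `|x1 x| <= enorm x.
Proof. exact: coord_le_enorm. Qed.

Lemma sqnorm_evec x h i :
  sqnorm (x + h *: evec R i) = sqnorm x + 2 * x ord0 i * h + h ^+ 2.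
Proof.
rewrite /sqnorm (bigD1 i)//= [in RHS](bigD1 i)//= !mxE !eqxx mulr1.
rewrite (eq_bigr (fun j => x ord0 j ^+ 2)) => [|j ji].
  by ring.
by rewrite !mxE (negbTE ji) andbF mulr0 addr0.
Qed.

End EuclideanNorm.

(** * Minima of semicontinuous functions, connectedness, second differences *)

Section RealAnalysis.
Context {R : realType}.

(** Compactness is used twice in near-covering form: with levels tending to $-\infty$ it bounds [g]
    below, and with levels decreasing to the infimum it shows that an infimum which is not attained
    would be exceeded by a uniform margin. *)
Lemma compact_lsc_min (T : topologicalType) (C : set T) (g : T -> R) :
  compact C -> C !=set0 ->
  (forall x, C x -> forall a, a < g x -> \forall y \near x, C y -> a < g y) ->
  exists2 x, C x & forall y, C y -> g x <= g y.
Proof.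
move=> /compact_near_coveringP cC [x0 Cx0] lsc.
pose P m x := C x -> m < g x.
have [m mP] : exists m, forall x, C x -> m < g x.
  have /filter_ex[m mP] : \forall m \near -oo%R, C `<=` P m.
    apply: cC => x Cx; exists ([set y | P (g x - 1) y], [set m | m < g x - 1]).
      split; last exact: nbhs_ninfty_lt (num_real _).
      by apply: lsc Cx _ _; rewrite ltrBlDr ltrDl.
    by move=> [y m]/= [yP mP] Cy; apply: lt_trans mP (yP Cy).
  by exists m => x Cx; exact: mP.
pose i := inf (g @` C).
have hi : has_inf (g @` C).
  by split; [exists (g x0), x0 | exists m => _ [x Cx <-]; exact/ltW/mP].
have ile x : C x -> i <= g x by move=> Cx; apply: ge_inf hi.2 _ _; exists x.
have [[x Cx gx]|nmin] := pselect (exists2 x, C x & g x <= i).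
  by exists x => // y Cy; apply: le_trans gx (ile _ Cy).
have ilt x : C x -> i < g x.
  by move=> Cx; rewrite ltNge; apply/negP => gx; apply: nmin; exists x.
have near_k : \forall k \near i^'+, C `<=` P k.
  apply: cC => x Cx.
  pose a := (i + g x) / 2.
  have [ia ag] := midf_lt (ilt _ Cx).
  exists ([set y | P a y], [set k | k < a]).
    split; last exact: nbhs_right_lt.
    exact: lsc Cx _ ag.
  by move=> [y k]/= [yP kP] Cy; apply: lt_trans kP (yP Cy).
have /filter_ex[k [ik kP]] : \forall k \near i^'+, i < k /\ C `<=` P k.
  by apply: filterI; [exact: nbhs_right_gt | exact: near_k].
have : k <= i by apply: lb_le_inf hi.1 _ => _ [x Cx <-]; exact/ltW/kP.
by rewrite leNgt ik.
Qed.

(** A nonempty, relatively open and closed subset of a connected interval is everything. This serves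
    both the chain of balls in [strong_maximum] and the sliding of centres. *)
Lemma unit_interval_connected (P : R -> Prop) :
  P 0 ->
  (forall s, 0 <= s <= 1 -> P s -> exists2 d, 0 < d &
     forall r, 0 <= r <= 1 -> `|r - s| < d -> P r) ->
  (forall s, 0 <= s <= 1 ->
     (forall d, 0 < d -> exists r, [/\ 0 <= r <= 1, `|r - s| < d & P r]) ->
     P s) ->
  forall s, 0 <= s <= 1 -> P s.
Proof.
move=> P0 oP cP s s01; pose B := `[0, 1]%classic `&` [set s | P s].
have I01 (r : R) : `[0, 1]%classic r = (0 <= r <= 1) :> Prop by rewrite /= in_itv.
suff : B = `[0, 1]%classic.
  by move=> /seteqP[_ /(_ s)]; rewrite I01 => /(_ s01)[].
have := @segment_connected R 0 1; apply.
- by exists 0; split => //; rewrite I01 lexx ler01.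
- exists (\bigcup_(k in [set k : R * R | 0 <= k.1 <= 1 /\ 0 < k.2 /\
      forall r, 0 <= r <= 1 -> `|r - k.1| < k.2 -> P r]) ball k.1 k.2).
    by apply: bigcup_open => k _; exact: ball_open.
  apply/seteqP; split => r.
    move=> [r01 Pr]; split => //; move: r01; rewrite I01 => r01.
    have [d d0 dP] := oP _ r01 Pr.
    by exists (r, d) => //; exact: ballxx.
  move=> [r01 [[k d]/= [k01 [d0 kP]]]]; rewrite /ball/= distrC => rk.
  by split => //; apply: kP rk; rewrite I01 in r01.
- exists (closure B); first exact: closed_closure.
  apply/seteqP; split => r; first by move=> Br; split; [case: Br|exact: subset_closure].
  move=> [r01 clr]; split => //; rewrite I01 in r01; apply: cP r01 _ => d d0.
  have /(_ _ (nbhsx_ballx r d d0)) := clr.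
  move=> [t [[t01 Pt]]]; rewrite /ball/= distrC => rt.
  by exists t; rewrite I01 in t01.
Qed.

(** Symmetrization removes the first-order term. The mean value theorem is applied to
    $p(r)+p(-r)-lr^2$, whose derivative is $o(r)$ by differentiability of [dp] at the single point
    0. *)
Lemma second_difference (p dp : R -> R) (l : R) :
  (\forall s \near (0 : R), is_derive (s : R) 1 p (dp s)) -> is_derive (0 : R) 1 dp l ->
  (p s + p (- s) - 2 * p 0) / s ^+ 2 @[s --> 0^'] --> l.
Proof.
move=> /nbhs_ballP[d1 /= d1_gt0 pdp] [ddp <-].
move: ddp; rewrite /derivable => /cvgrPdist_lt ddp.
apply/cvgrPdist_le => e e0.
have /nbhs_ballP[d2 /= d2_gt0 dpl] := ddp _ (divr_gt0 e0 (ltr0n _ 2)).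
set L : R := 'D_1 dp 0; rewrite -[lim _]/L in dpl.
have dpE h : 0 < `|h| < d2 -> `|dp h - dp 0 - L * h| <= e / 2 * `|h|.
  move=> /andP[h0 hd].
  have hn0 : h != 0 by rewrite -normr_gt0.
  have := dpl h; rewrite /ball/= sub0r normrN => /(_ hd hn0).
  rewrite /= addr0 -[h *: _]/(h * _) mulr1 -[h^-1 *: _]/(h^-1 * _) => hL.
  have -> : dp h - dp 0 - L * h = - (h * (L - h^-1 * (dp h - dp 0))) by field.
  by rewrite normrN normrM mulrC ler_wpM2r// ltW.
pose d := Num.min d1 d2.
have d0 : 0 < d by rewrite lt_min d1_gt0.
suff main s : 0 < s < d -> `|p s + p (- s) - 2 * p 0 - L * s ^+ 2| <= e * s ^+ 2.
  apply/nbhs_ballP; exists d => // s; rewrite /ball/= sub0r normrN => sd sn0.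
  have s2 : 0 < s ^+ 2 by rewrite exprn_even_gt0.
  have -> : L - (p s + p (- s) - 2 * p 0) / s ^+ 2 =
      - ((p s + p (- s) - 2 * p 0 - L * s ^+ 2) / s ^+ 2) by field.
  rewrite normrN normrM normfV (gtr0_norm s2) ler_pdivrMr//.
  have [s0|s0] := ltP 0 s.
    by apply: main; rewrite s0 -(gtr0_norm s0).
  have sN : 0 < - s < d.
    by rewrite oppr_gt0 lt_neqAle sn0 s0/= -(ler0_norm s0).
  by have := main _ sN; rewrite opprK sqrrN (addrC (p (- s))).
move=> /andP[s0]; rewrite lt_min => /andP[sd1 sd2].
pose X r := p r + p (- r) - L * r ^+ 2.
pose dX r := dp r - dp (- r) - 2 * L * r.
have dXP (r : R) : `|r| < d1 -> is_derive r 1 X (dX r).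
  move=> rd.
  have h1 : is_derive r 1 p (dp r) by apply: pdp; rewrite /ball/= sub0r normrN.
  have h2 : is_derive (- r) 1 p (dp (- r)).
    by apply: pdp; rewrite /ball/= opprK add0r.
  have h3 : is_derive r 1 (fun r => - r) (- 1 : R) by apply: is_deriveN.
  have h4 := @is_derive1_comp _ p (fun r => - r) _ _ _ h2 h3.
  rewrite /X /dX.
  apply: is_derive_eq.
  rewrite /GRing.scale/=; ring.
have [||c cI Xc] := @MVT R X dX 0 s s0.
- move=> r; rewrite in_itv/= => /andP[r0 rs]; apply: dXP.
  by rewrite gtr0_norm// (lt_trans rs).
- apply: derivable_within_continuous => r; rewrite in_itv/= => /andP[r0 rs].
  by have [] : is_derive r 1 X (dX r)
    by apply: dXP; rewrite ger0_norm// (le_lt_trans rs).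
move: cI; rewrite in_itv/= => /andP[c0 cs].
have -> : p s + p (- s) - 2 * p 0 - L * s ^+ 2 = dX c * s.
  by move: Xc; rewrite subr0 => <-; rewrite /X oppr0; ring.
have cd2 : `|c| < d2 by rewrite gtr0_norm// (lt_trans cs).
have h1 : `|dp c - dp 0 - L * c| <= e / 2 * c.
  by have := dpE c; rewrite (gtr0_norm c0); apply; rewrite c0 -(gtr0_norm c0).
have h2 : `|dp (- c) - dp 0 - L * - c| <= e / 2 * c.
  have := dpE (- c); rewrite normrN (gtr0_norm c0); apply.
  by rewrite c0 -(gtr0_norm c0).
have hX : `|dX c| <= e * c.
  have -> : dX c = (dp c - dp 0 - L * c) - (dp (- c) - dp 0 - L * - c).
    by rewrite /dX; ring.
  by apply: le_trans (ler_normB _ _) _; lra.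
rewrite normrM (gtr0_norm s0) expr2 mulrA ler_pM2r//.
by apply: le_trans hX _; rewrite ler_pM2l// ltW.
Qed.

End RealAnalysis.

(** * The Laplacian through second differences, with the explicit test functions *)

Section SecondDifferenceLaplacian.
Context {R : realType} {n : nat}.
Local Notation V := 'rV[R]_(n.+1).
Implicit Types (F G : V -> R) (x a z : V).

Definition secdiff F x (s : R) : R :=
  \sum_(i < n.+1) (F (x + s *: evec R i) + F (x - s *: evec R i) - 2 * F x) / s ^+ 2.

(* The Laplacian as a limit of symmetric second differences: linear in [F]
   without any differentiability side condition, and monotone at a minimum. *)
Definition haslap F x (L : R) : Prop := secdiff F x s @[s --> 0^'] --> L.

Lemma haslapD F G x L M :
  haslap F x L -> haslap G x M -> haslap (fun y => F y + G y) x (L + M).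
Proof.
rewrite /haslap => FL GM.
have -> : secdiff (fun y => F y + G y) x = secdiff F x \+ secdiff G x.
  apply/funext => s; rewrite /secdiff/= -big_split/=.
  by apply: eq_bigr => i _; rewrite -mulrDl; congr (_ * _); ring.
exact: cvgD.
Qed.

Lemma haslapZ k F x L : haslap F x L -> haslap (fun y => k * F y) x (k * L).
Proof.
rewrite /haslap => FL.
have -> : secdiff (fun y => k * F y) x = (fun s => k * secdiff F x s).
  apply/funext => s; rewrite /secdiff mulr_sumr.
  by apply: eq_bigr => i _; move: (s ^+ 2)^-1 => q; ring.
by apply: cvgM FL; exact: cvg_cst.
Qed.

Lemma haslap_cst (k : R) x : haslap (fun=> k) x 0.
Proof.
rewrite /haslap (_ : secdiff _ _ = fun=> 0); first exact: cvg_cst.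
apply/funext => s; rewrite /secdiff big1// => i _.
have -> : k + k - 2 * k = 0 by ring.
by rewrite mul0r.
Qed.

Lemma haslap_shift F x z L :
  haslap F (x - z) L -> haslap (fun y => F (y - z)) x L.
Proof.
rewrite /haslap (_ : secdiff F (x - z) = secdiff (fun y => F (y - z)) x)//.
by apply/funext => s; apply: eq_bigr => i _; rewrite !(addrAC x (- z)).
Qed.

Lemma haslap_near F G x L : (\forall y \near x, F y = G y) ->
  haslap F x L -> haslap G x L.
Proof.
move=> /nbhs_enormP[d d0 FG]; rewrite /haslap => FL.
apply: cvg_trans FL; apply: near_eq_cvg.
apply/nbhs_ballP; exists d => // s; rewrite /ball/= sub0r normrN => sd _.
apply: eq_bigr => i _.
have -> : F (x + s *: evec R i) = G (x + s *: evec R i).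
  by apply: FG; rewrite dist_evec.
have -> : F (x - s *: evec R i) = G (x - s *: evec R i).
  by apply: FG; rewrite -scaleNr dist_evec normrN.
by rewrite (FG x)// subrr enorm0.
Qed.

Lemma haslap_min F x L : (\forall y \near x, F x <= F y) ->
  haslap F x L -> 0 <= L.
Proof.
move=> /nbhs_enormP[d d0 Fx] FL.
rewrite -(cvg_lim (@Rhausdorff R) FL); apply: limr_ge; first exact: cvgP FL.
apply/nbhs_ballP; exists d => // s; rewrite /ball/= sub0r normrN => sd s0.
apply: sumr_ge0 => i _; rewrite divr_ge0 ?sqr_ge0//.
have h1 : F x <= F (x + s *: evec R i) by apply: Fx; rewrite dist_evec.
have h2 : F x <= F (x - s *: evec R i).
  by apply: Fx; rewrite -scaleNr dist_evec normrN.
by lra.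
Qed.

Lemma haslap_lines F x (dp : 'I_n.+1 -> R -> R) (l : 'I_n.+1 -> R) :
  (forall i, \forall s \near (0 : R),
     is_derive (s : R) 1 (fun s => F (x + s *: evec R i)) (dp i s)) ->
  (forall i, is_derive (0 : R) 1 (dp i) (l i)) ->
  haslap F x (\sum_i l i).
Proof.
move=> dF ddF.
apply: (@cvgr_sum _ _ (0^') _ _ _ (fun i (s : R) =>
  (F (x + s *: evec R i) + F (x - s *: evec R i) - 2 * F x) / s ^+ 2)) => i.
have := second_difference (dF i) (ddF i); rewrite scale0r addr0.
by under eq_fun do rewrite scaleNr.
Qed.

Lemma is_derive_line F x v (s : R) : derivable F (x + s *: v) v ->
  is_derive s 1 (fun s => F (x + s *: v)) ('D_v F (x + s *: v)).
Proof.
have E : (fun h : R => h^-1 *: (((fun s => F (x + s *: v)) \o shift s) (h *: 1) -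
    F (x + s *: v))) = (fun h => h^-1 *: ((F \o shift (x + s *: v)) (h *: v) -
    F (x + s *: v))).
  apply/funext => h /=; congr (_ *: (F _ - _)).
  by rewrite -[h *: 1]/(h * 1) mulr1 scalerDl addrCA.
by move=> dF; split; rewrite /derivable /derive E.
Qed.

Lemma haslap_C2 F x :
  (\forall y \near x, forall i, derivable F y (evec R i)) ->
  (forall i, derivable (pd i F) x (evec R i)) ->
  haslap F x (laplacian F x).
Proof.
move=> /nbhs_enormP[d d0 dF] ddF.
apply: (@haslap_lines _ _ (fun i s => pd i F (x + s *: evec R i))) => i.
  apply/nbhs_ballP; exists d => // s; rewrite /ball/= sub0r normrN => sd.
  by apply: is_derive_line; apply: dF; rewrite dist_evec.
have := @is_derive_line (pd i F) x (evec R i) 0; rewrite scale0r addr0; apply.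
exact: ddF.
Qed.

Lemma haslap_sqnorm x a : haslap (fun y => sqnorm (y - a)) x (2 * n.+1%:R).
Proof.
have -> : 2 * n.+1%:R = \sum_(i < n.+1) (2 : R).
  by rewrite sumr_const card_ord mulr_natr.
apply: (@haslap_lines _ _ (fun i s => 2 * (x - a) ord0 i + 2 * s)) => i.
  apply/nbhs_ballP; exists 1; first exact: ltr01.
  move=> s _.
  rewrite (_ : (fun s => _) = fun s : R =>
      sqnorm (x - a) + 2 * (x - a) ord0 i * s + s ^+ 2); last first.
    by apply/funext => r; rewrite addrAC sqnorm_evec.
  by apply: is_derive_eq; rewrite /GRing.scale/=; ring.
by apply: is_derive_eq; rewrite /GRing.scale/=; ring.
Qed.

(** Barrier for the strong maximum principle: for large [A] its Laplacian is a large positive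
    multiple of itself away from the centre. *)
Definition gaussian (A : R) a x : R := expR (- A * sqnorm (x - a)).

Lemma haslap_gaussian A a x : haslap (gaussian A a) x
  ((4 * A ^+ 2 * sqnorm (x - a) - 2 * A * n.+1%:R) * gaussian A a x).
Proof.
pose b i := (x - a) ord0 i.
have -> : (4 * A ^+ 2 * sqnorm (x - a) - 2 * A * n.+1%:R) * gaussian A a x =
    \sum_(i < n.+1) (4 * A ^+ 2 * b i ^+ 2 - 2 * A) * gaussian A a x.
  rewrite -mulr_suml; congr (_ * _).
  by rewrite sumrB -mulr_sumr sumr_const card_ord mulr_natr.
pose q i (s : R) := - A * (sqnorm (x - a) + 2 * b i * s + s ^+ 2).
pose dq i (s : R) := - A * (2 * b i + 2 * s).
have dqP i (s : R) : is_derive s 1 (fun s => expR (q i s)) (expR (q i s) * dq i s).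
  have dqq : is_derive s 1 (q i) (dq i s).
    by rewrite /q /dq; apply: is_derive_eq; rewrite /GRing.scale/=; ring.
  exact: is_derive1_comp (is_derive_expR _) dqq.
apply: (@haslap_lines _ _ (fun i s => expR (q i s) * dq i s)) => i.
  apply/nbhs_ballP; exists 1; first exact: ltr01.
  move=> s _.
  rewrite (_ : (fun s => _) = fun s : R => expR (q i s))//.
  by apply/funext => r; rewrite /gaussian addrAC sqnorm_evec.
have ddq : is_derive (0 : R) 1 (dq i) (- 2 * A).
  by rewrite /dq; apply: is_derive_eq; rewrite /GRing.scale/=; ring.
have := is_deriveM (dqP i 0) ddq.
have -> : expR (q i 0) = gaussian A a x.
  by rewrite /gaussian /q; congr expR; ring.
move=> h; apply: is_derive_eq h _; rewrite /GRing.scale/= /dq; ring.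
Qed.

Lemma continuous_gaussian A a : continuous (gaussian A a).
Proof.
move=> x.
have cs : {for x, continuous (fun y : V => sqnorm (y - a))}.
  exact: (continuous_subr continuous_sqnorm).
apply: (@continuous_comp _ _ _ (fun y : V => - A * sqnorm (y - a)) expR).
  exact: (continuousM (@cst_continuous _ _ (- A) x) cs).
exact: continuous_expR.
Qed.

End SecondDifferenceLaplacian.

(** Difference quotients towards the past are nonpositive. Asking nothing of later times allows a
    minimum at the final time of a cylinder. *)
Lemma left_min_derive_le0 {R : realType} (g : R -> R) (t d e : R) :
  0 < e -> is_derive t 1 g d ->
  (forall s, t - e < s <= t -> g t <= g s) -> d <= 0.
Proof.
move=> e0 [dg <-] gmin; rewrite leNgt; apply/negP => d0.
move: dg; rewrite /derivable => /cvgrPdist_lt /(_ _ d0) /nbhs_ballP[r /= r0 rP].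
pose h := - (Num.min e r / 2).
have m0 : 0 < Num.min e r by rewrite lt_min e0.
have [me mr] : Num.min e r <= e /\ Num.min e r <= r by rewrite !ge_min !lexx orbT.
have h0 : h < 0 by rewrite oppr_lt0 divr_gt0.
have := rP h; rewrite /ball/= sub0r normrN ltr0_norm// opprK.
move=> /(_ _ (ltr0_neq0 h0)) => /(_ _); rewrite -[lim _]/('D_1 g t).
rewrite -[h *: 1]/(h * 1) mulr1 -[_ *: _]/(_ * _).
have gh : g t <= g (h + t) by apply: gmin; rewrite /h; lra.
have : h^-1 * (g (h + t) - g t) <= 0.
  by rewrite mulr_le0_ge0 ?subr_ge0// invr_le0 ltW.
move=> h1 h2.
have /h2 : Num.min e r / 2 < r by lra.
by rewrite ltr_norml; move: h1; lra.
Qed.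

(** * The half-relaxed limit is a viscosity supersolution *)

Section RelaxedLimit.
Context {R : realType} {n : nat}.
Local Notation V := 'rV[R]_(n.+1).
Variables (f : R -> R) (Om : set V) (u : R -> V -> R).
Implicit Types (x y z : V) (t T a e : R).

Definition parabolic_solution := forall t x, Om x ->
  exists2 L, haslap (u t) x L & is_derive t 1 (fun s => u s x) (L + f (u t x)).

Definition eventually_ge x m := exists2 e, 0 < e & exists T, forall t y,
  T <= t -> enorm (y - x) < e -> Om y -> m <= u t y.

(* The half-relaxed lower limit, liminf of u(t,y) as t -> +oo and y -> x. *)
Definition lower_limit x : R := sup [set m | eventually_ge x m].

Hypothesis Om_open : open Om.
Hypothesis u01 : forall t x, Om x -> 0 < u t x < 1.
Hypothesis u_cont : forall t x, Om x ->
  {for (t, x), continuous (fun p : R * V => u p.1 p.2)}.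
Hypothesis u_sol : parabolic_solution.
Hypothesis f_cont : continuous f.

Local Notation w := lower_limit.

Lemma eventually_ge_has_sup x : Om x -> has_sup [set m | eventually_ge x m].
Proof.
move=> Ox; split.
  by exists 0, 1 => //; exists 0 => t y _ _ /(u01 t)/andP[/ltW].
exists 1 => m [e e0 [T h]].
have := h T x (lexx T); rewrite subrr enorm0 => /(_ e0 Ox) /le_trans; apply.
by have /andP[_ /ltW] := u01 T Ox.
Qed.

Lemma lower_limit_gt x a : Om x -> a < w x ->
  exists2 e, 0 < e & exists T, forall t y,
    T <= t -> enorm (y - x) < e -> Om y -> a < u t y.
Proof.
move=> Ox aw; have d0 : 0 < w x - a by rewrite subr_gt0.
have [m [e e0 [T h]] am] := sup_adherent d0 (eventually_ge_has_sup Ox).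
exists e => //; exists T => t y Tt yx Oy.
by apply: lt_le_trans (h t y Tt yx Oy); move: am; rewrite -/(w x); lra.
Qed.

Lemma lower_limit_ge x a : Om x -> eventually_ge x a -> a <= w x.
Proof. by move=> Ox h; apply: sup_upper_bound (eventually_ge_has_sup Ox) _ h. Qed.

Lemma lower_limit_ge0 x : Om x -> 0 <= w x.
Proof.
move=> Ox; apply: lower_limit_ge => //; exists 1 => //; exists 0 => t y _ _.
by move=> /(u01 t)/andP[/ltW].
Qed.

Lemma lower_limit_le1 x : Om x -> w x <= 1.
Proof.
move=> Ox; rewrite leNgt; apply/negP => /(lower_limit_gt Ox)[e e0 [T h]].
have := h T x (lexx T); rewrite subrr enorm0 => /(_ e0 Ox).
by have /andP[_ u1] := u01 T Ox; rewrite ltNge (ltW u1).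
Qed.

Lemma lower_limit_lt x a e T : Om x -> w x < a -> 0 < e ->
  exists t y, [/\ T <= t, enorm (y - x) < e, Om y & u t y < a].
Proof.
move=> Ox wa e0; apply: contrapT => h.
move: wa; rewrite ltNge; apply/negP; rewrite negbK.
apply: lower_limit_ge => //; exists e => //; exists T => t y Tt yx Oy.
by rewrite leNgt; apply/negP => uya; apply: h; exists t, y.
Qed.

Lemma lower_limit_lsc x a : Om x -> a < w x ->
  \forall y \near x, Om y -> a < w y.
Proof.
move=> Ox aw; have [am mw] := midf_lt aw.
have [e e0 [T h]] := lower_limit_gt Ox mw.
apply/nbhs_enormP; exists (e / 2); first by rewrite divr_gt0.
move=> y yx Oy; apply: lt_le_trans am _; apply: lower_limit_ge => //.
exists (e / 2); first by rewrite divr_gt0.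
exists T => t z Tt zy Oz; apply/ltW/h => //.
by have := enorm_triangle y z x; lra.
Qed.

Lemma lower_limit_le_cvg x l : Om x -> u t x @[t --> +oo] --> l -> w x <= l.
Proof.
move=> Ox ul; rewrite leNgt; apply/negP => lw; have [lm mw] := midf_lt lw.
have [e e0 [T h]] := lower_limit_gt Ox mw.
suff : (l + w x) / 2 <= l by rewrite leNgt lm.
rewrite -[leRHS](cvg_lim (@Rhausdorff R) ul); apply: limr_ge; first exact: cvgP ul.
have := nbhs_pinfty_ge (num_real T); apply: filterS => t Tt.
by apply/ltW/h; rewrite // subrr enorm0.
Qed.

(** A Dini-type argument: each point has a neighbourhood and a time after which the bound holds, and
    compactness makes the time uniform. *)
Lemma eventually_ge_compact (C : set V) (q : V -> R) e :
  compact C -> C `<=` Om -> 0 < e ->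
  (forall x, C x -> {for x, continuous q}) -> (forall x, C x -> q x <= w x) ->
  exists T, forall t x, T <= t -> C x -> q x - e <= u t x.
Proof.
move=> /compact_near_coveringP cC CO e0 qc qw.
have [M [_ MP]] : \forall t \near +oo%R, C `<=` (fun x => q x - e <= u t x).
  apply: cC => x Cx; have Ox := CO _ Cx.
  have qe : q x - e / 2 < w x by have := qw _ Cx; lra.
  have [d d0 [T h]] := lower_limit_gt Ox qe.
  have e2 : 0 < e / 2 by rewrite divr_gt0.
  have [d' d'0 h'] := (continuousP_enorm q x).1 (qc _ Cx) _ e2.
  exists ([set y | enorm (y - x) < Num.min d d' /\ Om y], [set t | T < t]).
    split; last exact: nbhs_pinfty_gt (num_real _).
    apply: filterI; last exact: open_nbhs_nbhs.
    by apply: near_enorm; rewrite lt_min d0.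
  move=> [y t]/= [[]]; rewrite lt_min => /andP[yd yd'] Oy /ltW Tt.
  have := h t y Tt yd Oy; have := h' _ yd'.
  by rewrite ltr_norml => /andP[_]; lra.
exists (M + 1) => t x Mt; apply: MP; apply: lt_le_trans Mt.
by rewrite ltrDl.
Qed.

(** The spatial minimum gives $\Delta u\ge L$, the minimum over past times gives $u_t\le da$, and
    the equation links the two. *)
Lemma parabolic_min (a : R -> R) (q : V -> R) t x (da L e : R) :
  Om x -> 0 < e -> is_derive t 1 a da -> haslap q x L ->
  (forall s, t - e < s <= t -> u t x - a t <= u s x - a s) ->
  (\forall y \near x, u t x - q x <= u t y - q y) ->
  L + f (u t x) <= da.
Proof.
move=> Ox e0 ada qL tmin xmin; have [M uM du] := u_sol t Ox.
have : 0 <= M + (-1) * L.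
  apply: (haslap_min (F := fun y => u t y + -1 * q y) (x := x)); last first.
    exact: haslapD uM (haslapZ (k := -1) qL).
  by apply: filterS xmin => y; rewrite !mulN1r.
have : M + f (u t x) - da <= 0.
  by apply: left_min_derive_le0 e0 (is_deriveB du ada) tmin.
by lra.
Qed.

(** If the inequality failed, [u] minus a perturbed [q] would have a minimum on a late space-time
    cylinder, close to [x], violating [parabolic_min]. The perturbation is quadratic in space and
    linear in time, to keep the minimum off the lateral boundary and the initial time. *)
Lemma lower_limit_supersolution x (q L : V -> R) :
  Om x -> q x = w x ->
  (\forall y \near x, [/\ q y <= w y, {for y, continuous q} & haslap q y (L y)]) ->
  {for x, continuous L} ->
  L x + f (w x) <= 0.
Proof.
move=> Ox qx /nbhs_enormP[r0 r0_gt0 qP] Lc; rewrite leNgt; apply/negP => pos.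
(* The excess is [8 * th]. It has to absorb four errors of size at most [th]: the variations of [L]
   and of [f], the Laplacian of the spatial penalty, and the slope in time. *)
pose th := (L x + f (w x)) / 8.
have th0 : 0 < th by rewrite divr_gt0.
(* The penalty $k_2|y-x|^2$ has Laplacian exactly [th]. *)
pose k2 := th / (2 * n.+1%:R).
have N0 : 0 < 2 * n.+1%:R :> R by rewrite mulr_gt0.
have k20 : 0 < k2 by rewrite divr_gt0.
have qc : {for x, continuous q} by have [] := qP x; rewrite // subrr enorm0.
have [rL rL0 rLP] := (continuousP_enorm L x).1 Lc _ th0.
have /cvgrPdist_lt/(_ _ th0)/nbhs_ballP[eta /= eta0 etaP] := @f_cont (w x).
have eta2 : 0 < eta / 2 by rewrite divr_gt0.
have [rq rq0 rqP] := (continuousP_enorm q x).1 qc _ eta2.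
have /nbhs_enormP[rO rO0 rOP] : nbhs x Om by exact: open_nbhs_nbhs.
pose r := Num.min (Num.min rL rq) (Num.min rO r0) / 2.
have m0 : 0 < Num.min (Num.min rL rq) (Num.min rO r0).
  by rewrite !lt_min rL0 rq0 rO0.
have r_gt0 : 0 < r by rewrite divr_gt0.
have [[rrL rrq] [rrO rr0]] : (r < rL /\ r < rq) /\ (r < rO /\ r < r0).
  have : r < Num.min (Num.min rL rq) (Num.min rO r0) by rewrite /r; lra.
  by rewrite !lt_min => /andP[/andP[-> ->] /andP[-> ->]].
(* Below, [Phi] is less than [3 * e] at its minimum and the unpenalized difference is at least
   [- e], so each penalty is under [4 * e]. This is less than [k2 * r ^+ 2] and [th], their values
   on the sphere and at the initial time. *)
pose e := Num.min eta (Num.min (k2 * r ^+ 2) th) / 8.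
have me0 : 0 < Num.min eta (Num.min (k2 * r ^+ 2) th).
  by rewrite !lt_min eta0 th0 mulr_gt0 ?exprn_gt0.
have e0 : 0 < e by rewrite divr_gt0.
have [e_eta [e_k e_th]] : 8 * e <= eta /\ (8 * e <= k2 * r ^+ 2 /\ 8 * e <= th).
  have : 8 * e <= Num.min eta (Num.min (k2 * r ^+ 2) th) by rewrite /e; lra.
  by rewrite !le_min => /andP[-> /andP[-> ->]].
pose B := [set y : V | enorm (y - x) <= r].
have BO : B `<=` Om by move=> y /= yr; apply: rOP; exact: le_lt_trans rrO.
have Bq y : B y -> [/\ q y <= w y, {for y, continuous q} & haslap q y (L y)].
  by move=> /= yr; apply: qP; exact: le_lt_trans rr0.
have [T TP] : exists T, forall t y, T <= t -> B y -> q y - e <= u t y.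
  apply: eventually_ge_compact => //; first exact: compact_eball.
    by move=> y /Bq[].
  by move=> y /Bq[].
have [d d0 dP] := (continuousP_enorm q x).1 qc _ e0.
have [ds ds0 dsP] : exists2 ds, 0 < ds &
    forall y, enorm (y - x) < ds -> k2 * sqnorm (y - x) < e.
  have sc : {for x, continuous (fun y : V => sqnorm (y - x))}.
    exact: continuous_subr continuous_sqnorm _.
  have [ds ds0 h] := (continuousP_enorm _ x).1 sc _ (divr_gt0 e0 k20).
  exists ds => // y /h; rewrite subrr sqnorm0 subr0 ger0_norm ?sqnorm_ge0//.
  by rewrite ltr_pdivlMr// mulrC.
(* [T + 1] leaves room for a cylinder of unit length in time, on all of which the uniform lower
   bound [TP] holds. *)
have [tn [yn [Ttn]]] : exists t y, [/\ T + 1 <= t,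
    enorm (y - x) < Num.min r (Num.min d ds), Om y & u t y < w x + e].
  by apply: lower_limit_lt; rewrite ?ltrDl ?lt_min ?r_gt0 ?d0.
rewrite !lt_min => /and3P[ynr ynd ynds] _ uyn.
pose Phi (p : R * V) := u p.1 p.2 - q p.2 + k2 * sqnorm (p.2 - x) - th * (p.1 - tn).
pose C := `[tn - 1, tn]%classic `*` B.
have CE (p : R * V) : C p <-> (tn - 1 <= p.1 <= tn) /\ B p.2.
  by rewrite /C /setX/= in_itv.
have Cn : C (tn, yn).
  by apply/CE; split; [rewrite /= lexx lerBlDr lerDl ler01 | exact: ltW].
have [[ts ys] /CE[/= /andP[ts1 tsn] Bys] smin] :
    exists2 p, C p & forall p', C p' -> Phi p <= Phi p'.
  apply: compact_lsc_min.
  - by apply: compact_setX; [exact: segment_compact | exact: compact_eball].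
  - by exists (tn, yn).
  move=> p /CE[_ Bp] a ap.
  have [_ qcp _] := Bq _ Bp.
  have Pc : {for p, continuous Phi}.
    have c2 : {for p, continuous (fun p : R * V => p.2)} by exact: cvg_snd.
    have c1 : {for p, continuous (fun p : R * V => p.1)} by exact: cvg_fst.
    apply: continuousB; last first.
      apply: continuousM; first exact: cst_continuous.
      by apply: continuousB => //; exact: cst_continuous.
    apply: continuousD; last first.
      apply: continuousM; first exact: cst_continuous.
      apply: (@continuous_comp _ _ _ (fun p : R * V => p.2)
        (fun y : V => sqnorm (y - x))) => //.
      exact: continuous_subr continuous_sqnorm _.
    apply: continuousB.
      by have := @u_cont p.1 p.2 (BO _ Bp); rewrite -surjective_pairing.
    exact: (@continuous_comp _ _ _ (fun p : R * V => p.2) q).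
  have /cvgrPdist_lt/(_ (Phi p - a)) := Pc; rewrite subr_gt0 => /(_ ap).
  by apply: filterS => p' + _; rewrite ltr_norml; lra.
have lowPhi t y : T <= t -> B y ->
    - e + k2 * sqnorm (y - x) - th * (t - tn) <= Phi (t, y).
  by move=> Tt By; have := TP t y Tt By; rewrite /Phi/=; lra.
have Phis : Phi (ts, ys) < 3 * e.
  have := smin _ Cn.
  have := dP _ ynd; have := dsP _ ynds; rewrite /Phi/= qx ltr_norml.
  by move=> h1 /andP[h2 h3]; move: uyn; lra.
have Tts : T <= ts by lra.
have := lowPhi _ _ Tts Bys => lows.
have sq0 : 0 <= k2 * sqnorm (ys - x) by rewrite mulr_ge0 ?sqnorm_ge0// ltW.
have tt0 : 0 <= th * (tn - ts) by rewrite mulr_ge0 ?subr_ge0// ltW.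
have tsE : th * (ts - tn) = - (th * (tn - ts)) by rewrite -mulrN opprB.
have ysr : enorm (ys - x) < r.
  rewrite -(@ltr_pXn2r _ 2%N)// ?nnegrE ?enorm_ge0 ?ltW// enorm_sqr.
  by rewrite -(ltr_pM2l k20); move: lows; rewrite tsE; lra.
have tsl : tn - 1 < ts.
  have : th * (tn - ts) < th * 1 by move: lows; rewrite tsE; lra.
  by rewrite ltr_pM2l//; lra.
have usx : `|w x - u ts ys| < eta.
  have := TP _ _ Tts Bys; have := rqP ys (lt_trans ysr rrq).
  move: Phis; rewrite /Phi/= qx tsE !ltr_norml => h1 /andP[h2 h3] h4.
  by apply/andP; split; lra.
have fs := etaP _ usx.
have Ls := rLP ys (lt_trans ysr rrL).
clear Phis lows sq0 tt0 tsE ynr ynd ynds uyn e_eta e_k e_th lowPhi usx.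
clear eta2 rrL rrq rrO rr0 rL0 rq0 rO0 r0_gt0 d0 ds0 Ttn Tts N0 e0.
have [_ _ qL] := Bq _ Bys.
have dth : is_derive ts 1 (fun s : R => th * s) th.
  by apply: is_derive_eq; rewrite /GRing.scale/=; ring.
have /= := parabolic_min (BO _ Bys) (_ : 0 < ts - (tn - 1)) dth
  (haslapD qL (haslapZ (k := - k2) (haslap_sqnorm ys x))).
rewrite subr_gt0 => /(_ tsl) H.
have {H} : L ys + - k2 * (2 * n.+1%:R) + f (u ts ys) <= th.
  apply: H.
    move=> s /andP[s1 s2].
    have /= := smin (s, ys); rewrite CE /Phi/= => H.
    have : tn - 1 <= s <= tn /\ B ys by split => //; apply/andP; split; lra.
    by move=> /H; lra.
  have rs : 0 < r - enorm (ys - x) by rewrite subr_gt0.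
  apply/nbhs_enormP; exists (r - enorm (ys - x)) => // y yys.
  have By : B y.
    by rewrite /B/=; have := enorm_triangle ys y x; lra.
  have /= := smin (ts, y); rewrite CE /Phi/= => H.
  have : tn - 1 <= ts <= tn /\ B y by split => //; apply/andP; split; lra.
  by move=> /H; lra.
have -> : - k2 * (2 * n.+1%:R) = - th by rewrite /k2 mulNr divfK// gt_eqF.
move: fs Ls; rewrite /ball/= !ltr_norml => /andP[_ h1] /andP[h2 _].
have thE : L x + f (w x) = 8 * th by rewrite /th; lra.
by lra.
Qed.

End RelaxedLimit.

(** * Strong maximum principle for supersolutions, and sliding of the profile *)

Section Supersolution.
Context {R : realType} {n : nat}.
Local Notation V := 'rV[R]_(n.+1).
Variables (f : R -> R) (Om : set V) (w : V -> R) (C : R).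
Implicit Types (x y z a : V) (psi : V -> R).

(** Viscosity sense, with [q] touching from below at [x]. The test needs a Laplacian in a whole
    neighbourhood, because for the relaxed limit the contact with [u] occurs only near [x];
    continuity of [L] at [x] then brings the inequality back to [x]. *)
Definition supersolution := forall x (q L : V -> R), Om x -> q x = w x ->
  (\forall y \near x, [/\ q y <= w y, {for y, continuous q} & haslap q y (L y)]) ->
  {for x, continuous L} -> L x + f (w x) <= 0.

Definition solution_at psi y :=
  [/\ 0 <= psi y <= 1, {for y, continuous psi} & haslap psi y (- f (psi y))].

Hypothesis Om_open : open Om.
Hypothesis w01 : forall x, Om x -> 0 <= w x <= 1.
Hypothesis w_lsc : forall x (b : R), Om x -> b < w x ->
  \forall y \near x, Om y -> b < w y.
Hypothesis w_super : supersolution.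
Hypothesis f_cont : continuous f.
Hypothesis f0 : f 0 = 0.
Hypothesis C0 : 0 <= C.
Hypothesis f_lip : forall b c, 0 <= b <= 1 -> 0 <= c <= 1 ->
  `|f b - f c| <= C * `|b - c|.

Lemma lsc_gt x psi : Om x -> {for x, continuous psi} -> psi x < w x ->
  \forall y \near x, psi y < w y.
Proof.
move=> Ox pc pw; have [pm mw] := midf_lt pw.
have d0 : 0 < (psi x + w x) / 2 - psi x by rewrite subr_gt0.
have /cvgrPdist_lt/(_ _ d0) := pc.
have On : nbhs x Om by exact: open_nbhs_nbhs.
apply: filter_app; apply: filter_app (w_lsc Ox mw); apply: filterS On => y Oy.
move=> /(_ Oy) h; rewrite ltr_norml => /andP[h2 _].
by apply: le_lt_trans h; move: h2; lra.
Qed.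

(** Strictness is assumed at the centre, so a Gaussian centred there can be added to [psi]. If [w]
    touched [psi] at [x], the minimum of [w] minus the sum would fall in an annulus around the
    centre, where the Laplacian of the Gaussian beats the Lipschitz term. No boundary derivative is
    involved. *)
Lemma strong_maximum_ball a r psi :
  (forall y, enorm (y - a) < r -> [/\ Om y, solution_at psi y & psi y <= w y]) ->
  psi a < w a -> forall x, enorm (x - a) < r -> psi x < w x.
Proof.
move=> Hy pa x xr; rewrite ltNge; apply/negP => wx.
have r0 : 0 < r := le_lt_trans (enorm_ge0 _) xr.
have [Oa [pa01 pca _] _] : [/\ Om a, solution_at psi a & psi a <= w a].
  by apply: Hy; rewrite subrr enorm0.
pose m := (w a - psi a) / 2.
have m0 : 0 < m by rewrite divr_gt0// subr_gt0.
have /nbhs_enormP[r1 r1_gt0 r1P] : \forall y \near a, psi y + m < w y.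
  apply: lsc_gt => //; last by rewrite /m; lra.
  by apply: continuousD => //; exact: cst_continuous.
pose r2 := r1 / 2; have r2_gt0 : 0 < r2 by rewrite divr_gt0.
pose rx := (enorm (x - a) + r) / 2.
have [xrx rxr] : enorm (x - a) < rx /\ rx < r by rewrite /rx; lra.
have rx0 : 0 < rx := le_lt_trans (enorm_ge0 _) xrx.
pose N : R := n.+1%:R.
have r22 : 0 < 4 * r2 ^+ 2 by rewrite mulr_gt0// exprn_gt0.
(* Large enough that $4A^2s-2AN>C$ whenever $s\ge r_2^2$, as [coef] checks. *)
pose A := (2 * N + C + 1) / (4 * r2 ^+ 2) + 1.
have N0 : 0 <= N by exact: ler0n.
have A1 : 1 <= A by rewrite lerDr divr_ge0 ?(ltW r22)// !addr_ge0// mulr_ge0.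
have A0 : 0 < A by apply: lt_le_trans A1.
have Ar2 : 2 * N + C + 1 <= A * (4 * r2 ^+ 2).
  by rewrite -ler_pdivrMr// lerDl.
have coef (s : R) : r2 ^+ 2 <= s -> C < 4 * A ^+ 2 * s - 2 * A * N.
  move=> r2s.
  have h1 : A * (4 * r2 ^+ 2) <= A * (4 * s) by rewrite ler_pM2l// ler_pM2l.
  have h2 : A * (C + 1) <= A * (A * (4 * s) - 2 * N).
    by rewrite ler_pM2l//; lra.
  have h3 : 1 * (C + 1) <= A * (C + 1).
    by apply: ler_wpM2r A1; rewrite addr_ge0.
  have -> : 4 * A ^+ 2 * s - 2 * A * N = A * (A * (4 * s) - 2 * N) by ring.
  by lra.
pose G := gaussian A a.
pose g0 := expR (- A * rx ^+ 2).
have GP y : 0 < G y <= 1.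
  by rewrite expR_gt0 -expR0 ler_expR mulNr oppr_le0 mulr_ge0 ?sqnorm_ge0// ltW.
have g00 : 0 < g0 by exact: expR_gt0.
have Gin y : enorm (y - a) < rx -> g0 < G y.
  move=> yr; rewrite ltr_expR !mulNr ltrN2 ltr_pM2l// -enorm_sqr.
  by rewrite ltr_pXn2r// nnegrE ?enorm_ge0// ltW.
have Gout y : rx <= enorm (y - a) -> G y <= g0.
  move=> yr; rewrite ler_expR !mulNr lerN2 ler_pM2l// -enorm_sqr.
  by rewrite ler_pXn2r// nnegrE ?enorm_ge0// ltW.
pose e := m / 2; have e0 : 0 < e by rewrite divr_gt0.
pose phi y := psi y + e * G y.
have phic y : enorm (y - a) < r -> {for y, continuous phi}.
  move=> /Hy[_ [_ pc _] _]; apply: continuousD => //.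
  by apply: continuousM; [exact: cst_continuous | exact: continuous_gaussian].
have [x0 x0r x0min] : exists2 x0 : V, enorm (x0 - a) <= rx &
    (forall y, enorm (y - a) <= rx -> w x0 - phi x0 <= w y - phi y).
  apply: (@compact_lsc_min R V [set y | enorm (y - a) <= rx] (fun y => w y - phi y)).
  - exact: compact_eball.
  - by exists x; exact: ltW.
  move=> y /= yr b bw; have yr' := le_lt_trans yr rxr.
  have [Oy _ _] := Hy _ yr'.
  have : \forall t \near y, b + phi t < w t.
    apply: lsc_gt => //; last by lra.
    by apply: continuousD; [exact: cst_continuous | exact: phic].
  by apply: filterS => t h _; lra.
have [Ox0 [p001 p0c _] pw0] := Hy _ (le_lt_trans x0r rxr).
(* At [x] we have [w <= psi] and the Gaussian exceeds [g0]. On the sphere of radius [rx], where it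
   is at most [g0] and [w >= psi], so low a value is impossible. *)
have neg : w x0 - phi x0 < - e * g0.
  apply: le_lt_trans (x0min x (ltW xrx)) _.
  have := Gin _ xrx; rewrite -(ltr_pM2l e0) /phi => h.
  by lra.
(* Near the centre the gap exceeds [m = 2 * e], while the added Gaussian is at most [e], so the
   difference is positive there. *)
have x0r2 : r2 < enorm (x0 - a).
  rewrite ltNge; apply/negP => h.
  have /r1P : enorm (x0 - a) < r1.
    by apply: le_lt_trans h _; rewrite /r2; lra.
  have : e * G x0 <= e * 1 by rewrite ler_pM2l//; have /andP[] := GP x0.
  have : 0 < e * g0 by exact: mulr_gt0.
  move: neg; rewrite /phi mulNr.
  have me : m = 2 * e by rewrite /e; field.
  by rewrite me; lra.
have x0rx : enorm (x0 - a) < rx.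
  rewrite ltNge; apply/negP => /Gout; rewrite -(ler_pM2l e0) => h.
  by move: neg; rewrite /phi mulNr; lra.
pose mu := w x0 - phi x0.
pose c y := 4 * A ^+ 2 * sqnorm (y - a) - 2 * A * N.
pose L y := - f (psi y) + e * (c y * G y) + 0.
have super : L x0 + f (w x0) <= 0.
  apply: (@w_super x0 (fun y => psi y + e * G y + mu)) => //.
  - by rewrite /mu /phi; ring.
  - have d0 : 0 < rx - enorm (x0 - a) by rewrite subr_gt0.
    apply/nbhs_enormP; exists (rx - enorm (x0 - a)) => // y yx0.
    have yrx : enorm (y - a) < rx.
      by have := enorm_triangle x0 y a; move: yx0; lra.
    have yr := lt_trans yrx rxr.
    have [_ [_ _ pL] _] := Hy _ yr; split.
    + by have := x0min y (ltW yrx); rewrite -/mu /phi; lra.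
    + apply: continuousD; last exact: cst_continuous.
      exact: phic.
    + apply: haslapD (haslap_cst _ _); apply: haslapD pL _; apply: haslapZ.
      exact: haslap_gaussian.
  - apply: continuousD; last exact: cst_continuous.
    apply: continuousD.
      apply: continuousN; apply: (@continuous_comp _ _ _ psi f) => //.
      exact: f_cont.
    apply: continuousM; first exact: cst_continuous.
    apply: continuousM; last exact: continuous_gaussian.
    apply: continuousB; last exact: cst_continuous.
    apply: continuousM; first exact: cst_continuous.
    exact: continuous_subr continuous_sqnorm _.
have cC : C < c x0.
  by apply: coef; rewrite -enorm_sqr ler_pXn2r ?nnegrE ?enorm_ge0// ltW.
have /andP[G0 _] := GP x0.
have lip := f_lip (w01 Ox0) p001.
have wp : `|w x0 - psi x0| <= e * G x0.
  rewrite ger0_norm ?subr_ge0//.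
  have : 0 < e * g0 by exact: mulr_gt0.
  by move: neg; rewrite /phi mulNr; lra.
have h1 : C * `|w x0 - psi x0| <= C * (e * G x0) by rewrite ler_wpM2l.
have h2 : C * (e * G x0) < c x0 * (e * G x0) by rewrite ltr_pM2r// mulr_gt0.
move: super lip; rewrite /L addr0 mulrCA ler_norml => h3 /andP[h4 _].
by lra.
Qed.

(** Strictness is carried from [q] to the centre [z] along a segment. Balls of radius [d] about its
    points stay inside the large ball, so steps of uniform size suffice; one last use of
    [strong_maximum_ball] at [z] reaches every point. *)
Lemma strong_maximum z r psi q :
  (forall y, enorm (y - z) < r -> [/\ Om y, solution_at psi y & psi y <= w y]) ->
  enorm (q - z) < r -> psi q < w q -> forall x, enorm (x - z) < r -> psi x < w x.
Proof.
move=> Hy qr pq; apply: strong_maximum_ball => //.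
pose p (s : R) := q + s *: (z - q).
pose d := r - enorm (q - z); have d0 : 0 < d by rewrite subr_gt0.
(* The added 1 keeps [k] positive when [q = z]. *)
pose k := enorm (z - q) + 1.
have k0 : 0 < k by rewrite ltr_wpDl// enorm_ge0.
have pz (s : R) : 0 <= s <= 1 -> enorm (p s - z) <= enorm (q - z).
  move=> /andP[s0 s1].
  have -> : p s - z = (1 - s) *: (q - z).
    by rewrite /p; apply/rowP => i; rewrite !mxE; ring.
  by rewrite enormZ ger0_norm ?subr_ge0// ler_piMl ?enorm_ge0// gerBl.
have pp (s t : R) : enorm (p s - p t) <= `|s - t| * k.
  have -> : p s - p t = (s - t) *: (z - q).
    by rewrite /p; apply/rowP => i; rewrite !mxE; ring.
  by rewrite enormZ ler_wpM2l// lerDl.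
have step (s t : R) : 0 <= s <= 1 -> `|s - t| < d / k ->
    psi (p s) < w (p s) -> psi (p t) < w (p t).
  move=> s01 st /strong_maximum_ball; apply; last first.
    rewrite distrC in st; apply: le_lt_trans (pp t s) _.
    by rewrite -ltr_pdivlMr//; exact: st.
  move=> y ys; apply: Hy; have := enorm_triangle (p s) y z.
  by have := pz s s01; move: ys; rewrite /d; lra.
have dk : 0 < d / k by exact: divr_gt0.
have -> : z = p 1 by rewrite /p scale1r addrC subrK.
apply: (@unit_interval_connected R (fun s => psi (p s) < w (p s))).
- by rewrite /p scale0r addr0.
- move=> s s01 ps; exists (d / k) => // t t01 ts; apply: step ps => //.
  by rewrite distrC.
- move=> s s01 /(_ _ dk)[t [t01 ts pt]]; exact: step pt.
- by rewrite ler01 lexx.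
Qed.

Variables (Psi : V -> R) (R0 : R).
Hypothesis R0_gt0 : 0 < R0.
Hypothesis Psi_cont : continuous Psi.
Hypothesis Psi_out : forall x, R0 <= enorm x -> Psi x = 0.
Hypothesis Psi_in : forall x, enorm x < R0 ->
  0 < Psi x < 1 /\ haslap Psi x (- f (Psi x)).

(** Open balls, so that centres at distance exactly [R0] from the wall are admissible. *)
Definition ball_in_domain z := forall x, enorm (x - z) < R0 -> Om x.
Definition lies_above z := forall x, enorm (x - z) < R0 -> Psi (x - z) <= w x.

Lemma Psi_solution z x : enorm (x - z) < R0 ->
  solution_at (fun y => Psi (y - z)) x.
Proof.
move=> xz; have [/andP[P0 P1] Pl] := Psi_in xz; split.
- by rewrite !ltW.
- exact: continuous_subr Psi_cont _.
- exact: haslap_shift Pl.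
Qed.

Lemma zero_solution x : solution_at (fun=> 0) x.
Proof.
split; [by rewrite lexx ler01 | exact: cst_continuous |].
by rewrite f0 oppr0; exact: haslap_cst.
Qed.

(* If w touched Psi (. - z) in the ball, it would coincide with it there and
   vanish on the boundary sphere; but w > 0 on the ball centred at z', which
   covers part of that sphere. *)
Lemma lies_strictly_above z z' : ball_in_domain z -> ball_in_domain z' ->
  lies_above z -> 0 < enorm (z' - z) < R0 ->
  forall x, enorm (x - z) < R0 -> Psi (x - z) < w x.
Proof.
move=> Oz Oz' az /andP[d0 dR].
set d := enorm (z' - z) in d0 dR.
have dn0 : d != 0 by rewrite gt_eqF.
pose p (s : R) := z + (s / d) *: (z' - z).
have pz (s : R) : 0 <= s -> enorm (p s - z) = s.
  move=> s0; rewrite /p addrC addKr enormZ -/d ger0_norm ?divfK//.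
  by rewrite divr_ge0// ltW.
have pp (s t : R) : enorm (p s - p t) = `|s - t|.
  have -> : p s - p t = ((s - t) / d) *: (z' - z).
    by apply/rowP => i; rewrite !mxE; ring.
  by rewrite enormZ -/d normrM normfV (gtr0_norm d0) divfK.
have z'p : z' = p d.
  by rewrite /p divff// scale1r addrC subrK.
have wz' : 0 < w z'.
  have [/andP[P0 _] _] := Psi_in dR.
  exact: lt_le_trans P0 (az _ dR).
have pz' : enorm (p R0 - z') < R0.
  by rewrite {1}z'p pp ltr_norml; lra.
have wp : 0 < w (p R0).
  (* Since [f 0 = 0], the constant 0 is a solution below [w], so positivity at [z'] spreads to the
     whole ball around [z']. *)
  apply: (@strong_maximum z' R0 (fun=> 0) z') => //.
    move=> y yz'; split; [exact: Oz' | exact: zero_solution |].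
    by have /andP[] := w01 (Oz' _ yz').
  by rewrite subrr enorm0.
have Pp : Psi (p R0 - z) = 0 by apply: Psi_out; rewrite pz// ltW.
have /nbhs_enormP[e e0 eP] : \forall y \near p R0, Psi (y - z) < w y.
  apply: lsc_gt; [exact: Oz' | exact: continuous_subr Psi_cont _ |].
  by rewrite Pp.
pose s := R0 - Num.min e R0 / 2.
have m0 : 0 < Num.min e R0 by rewrite lt_min e0.
have [me mR] : Num.min e R0 <= e /\ Num.min e R0 <= R0 by rewrite !ge_min !lexx orbT.
have s0 : 0 <= s by rewrite /s; lra.
apply: (@strong_maximum z R0 (fun y => Psi (y - z)) (p s)).
- by move=> y yz; split; [exact: Oz | exact: Psi_solution | exact: az].
- by rewrite pz// /s; lra.
- by apply: eP; rewrite pp ltr_norml /s; lra.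
Qed.

(** The point [x] stays fixed while the centre moves, so continuity of [Psi] is enough and [w] may
    be discontinuous. *)
Lemma lies_above_closed z : ball_in_domain z ->
  (forall d, 0 < d -> exists z', enorm (z' - z) < d /\ lies_above z') ->
  lies_above z.
Proof.
move=> Oz cl x xz; rewrite leNgt; apply/negP => wP.
have e0 : 0 < Psi (x - z) - w x by rewrite subr_gt0.
have [d d0 dP] := (continuousP_enorm Psi (x - z)).1 (@Psi_cont _) _ e0.
have r0 : 0 < R0 - enorm (x - z) by rewrite subr_gt0.
have [|z' []] := cl (Num.min d (R0 - enorm (x - z))); first by rewrite lt_min d0.
rewrite lt_min => /andP[z'd z'r] az'.
have xz' : enorm (x - z') < R0.
  by have := enorm_triangle z x z'; rewrite (enormB z z'); move: z'r; lra.
have := az' _ xz'.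
have /dP : enorm ((x - z') - (x - z)) < d.
  have -> : x - z' - (x - z) = z - z' by apply/rowP => i; rewrite !mxE; ring.
  by rewrite enormB.
by rewrite ltr_norml; lra.
Qed.

(** On a slightly smaller closed ball the strict inequality is uniform and survives small shifts. On
    the sphere strictness may be lost, so the remaining thin shell is handled by a minimum
    principle. *)
Lemma lies_above_open z : ball_in_domain z -> lies_above z ->
  exists2 d, 0 < d & forall z', ball_in_domain z' -> enorm (z' - z) < d ->
    lies_above z'.
Proof.
move=> Oz az.
(* Strictness requires a second admissible centre within [R0]. Without one, [z] is isolated among
   admissible centres and the claim is trivial. *)
have [[z1 Oz1 z1z]|alone] := pselect (exists2 z1, ball_in_domain z1 &
    0 < enorm (z1 - z) < R0); last first.
  exists R0 => // z' Oz' z'z; suff -> : z' = z by [].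
  apply/eqP; rewrite -subr_eq0; apply/eqP/enorm_eq0/eqP.
  rewrite eq_le enorm_ge0 andbT leNgt; apply/negP => z'0.
  by apply: alone; exists z' => //; rewrite z'0.
have strict := lies_strictly_above Oz Oz1 az z1z.
(* On the annulus rho0 <= |x - z'| <= R0 the positive function
   1 + b (rho0^2 - |x - z'|^2) is a strict supersolution of the linearized
   equation, so the minimum principle holds there. *)
pose N : R := n.+1%:R.
have N1 : 1 <= N by rewrite ler1n.
have N0 : 0 < N by exact: lt_le_trans N1.
(* With this [b] the Laplacian of [G] is [- (C + 1)], and [tau] is small enough that [G] stays above
   1/2 up to radius [R0]. *)
pose b := (C + 1) / (2 * N).
have C1 : 0 < C + 1 by rewrite ltr_wpDl.
have b0 : 0 < b by rewrite divr_gt0// mulr_gt0.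
pose tau := Num.min (R0 / 2) (1 / (4 * R0 * b)).
have Rb0 : 0 < 4 * R0 * b by apply: mulr_gt0 b0; exact: mulr_gt0.
have tau0 : 0 < tau.
  by rewrite lt_min; apply/andP; split; exact: divr_gt0.
have [tauR taub] : tau <= R0 / 2 /\ tau <= 1 / (4 * R0 * b).
  by rewrite !ge_min !lexx orbT.
pose rho0 := R0 - tau.
have rho00 : 0 < rho0 by rewrite /rho0; lra.
have brho : b * (R0 ^+ 2 - rho0 ^+ 2) <= 1 / 2.
  have -> : R0 ^+ 2 - rho0 ^+ 2 = tau * (R0 + rho0) by rewrite /rho0; ring.
  have h1 : tau * (R0 + rho0) <= tau * (2 * R0).
    by rewrite ler_pM2l// /rho0; lra.
  have h2 : tau * (4 * R0 * b) <= 1 by rewrite -ler_pdivlMr.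
  have h3 : b * (tau * (R0 + rho0)) <= b * (tau * (2 * R0)) by rewrite ler_pM2l.
  by lra.
pose rho1 := (rho0 + R0) / 2.
have [rho01 rho1R] : rho0 < rho1 /\ rho1 < R0 by rewrite /rho1 /rho0; lra.
have /compact_near_coveringP cE := @compact_eball R n z rho1.
have near_z : \forall z' \near z,
    [set x | enorm (x - z) <= rho1] `<=` (fun x => Psi (x - z') < w x).
  apply: (cE V (nbhs z) (fun z' x => Psi (x - z') < w x)) => x /= xz.
  have xz' := le_lt_trans xz rho1R.
  have [pm mw] := midf_lt (strict _ xz').
  have h0 : 0 < (Psi (x - z) + w x) / 2 - Psi (x - z) by rewrite subr_gt0.
  have [d d0 dP] := (continuousP_enorm Psi (x - z)).1 (@Psi_cont _) _ h0.
  have d2 : 0 < d / 2 by rewrite divr_gt0.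
  exists ([set y | enorm (y - x) < d / 2 /\ (Psi (x - z) + w x) / 2 < w y],
          [set z' | enorm (z' - z) < d / 2]).
    split; last exact: near_enorm.
    apply: filterI; first exact: near_enorm.
    by apply: lsc_gt => //; [exact: Oz | exact: cst_continuous].
  move=> [y z']/= [[yx my] z'z]; apply: lt_trans my.
  have : enorm ((y - z') - (x - z)) < d.
    have -> : y - z' - (x - z) = (y - x) - (z' - z).
      by apply/rowP => i; rewrite !mxE; ring.
    by have := enormD (y - x) (- (z' - z)); rewrite enormN; lra.
  by move=> /dP; rewrite ltr_norml => /andP[_]; lra.
have /nbhs_enormP[d1 d10 d1P] := near_z.
exists (Num.min d1 (rho1 - rho0)); first by rewrite lt_min d10 subr_gt0.
move=> z' Oz'; rewrite lt_min => /andP[z'd z'r].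
have inner x : enorm (x - z') <= rho0 -> Psi (x - z') < w x.
  move=> xz'; apply: d1P => //=.
  by have := enorm_triangle z' x z; lra.
pose G x := 1 + b * (rho0 ^+ 2 - sqnorm (x - z')).
have Gc x : {for x, continuous G}.
  apply: continuousD; first exact: cst_continuous.
  apply: continuousM; first exact: cst_continuous.
  apply: continuousB; first exact: cst_continuous.
  exact: continuous_subr continuous_sqnorm _.
have Ghalf x : enorm (x - z') <= R0 -> 1 / 2 <= G x.
  move=> xR.
  have : b * sqnorm (x - z') <= b * R0 ^+ 2.
    by rewrite ler_pM2l// -enorm_sqr ler_pXn2r ?nnegrE ?enorm_ge0// ltW.
  by move: brho; rewrite /G; lra.
have Gle1 x : rho0 <= enorm (x - z') -> G x <= 1.
  move=> xr.
  have : b * rho0 ^+ 2 <= b * sqnorm (x - z').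
    by rewrite ler_pM2l// -enorm_sqr ler_pXn2r ?nnegrE ?enorm_ge0// ltW.
  by rewrite /G; lra.
have GL x : haslap G x (0 + b * (0 + -1 * (2 * N))).
  apply: haslapD; first exact: haslap_cst.
  apply: haslapZ.
  have := haslapD (haslap_cst (rho0 ^+ 2) x)
    (haslapZ (k := -1) (haslap_sqnorm x z')).
  by under [X in haslap X]eq_fun do rewrite mulN1r.
move=> x xR; rewrite leNgt; apply/negP => wP.
(* The value 0 on the sphere avoids evaluating [w] off the domain. Lower semicontinuity persists
   there because [Psi] tends to 0, [w] is nonnegative and [G] is at least 1/2. *)
pose g y := if enorm (y - z') < R0 then (w y - Psi (y - z')) / G y else 0.
have Gpos y : enorm (y - z') <= R0 -> 0 < G y.
  by move=> /Ghalf; apply: lt_le_trans; rewrite divr_gt0.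
have [x0 x0R x0min] : exists2 x0 : V, enorm (x0 - z') <= R0 &
    (forall y, enorm (y - z') <= R0 -> g x0 <= g y).
  apply: (@compact_lsc_min R V [set y | enorm (y - z') <= R0] g).
  - exact: compact_eball.
  - by exists x; exact: ltW.
  move=> y /= yR a; rewrite {1}/g; case: ifPn => [yR' ag|].
    have : \forall t \near y, a * G t + Psi (t - z') < w t.
      apply: lsc_gt; first exact: Oz'.
        apply: continuousD; last exact: continuous_subr Psi_cont _.
        by apply: continuousM; [exact: cst_continuous | exact: Gc].
      by move: ag; rewrite ltr_pdivlMr ?Gpos//; lra.
    have r0 : 0 < R0 - enorm (y - z') by rewrite subr_gt0.
    apply: filter_app; apply/nbhs_enormP; exists (R0 - enorm (y - z')) => // t ty ht _.
    have tR : enorm (t - z') < R0 by have := enorm_triangle y t z'; lra.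
    by rewrite /g tR ltr_pdivlMr ?Gpos ?ltW//; lra.
  rewrite -leNgt => yR' a0.
  have Py : Psi (y - z') = 0 by exact: Psi_out.
  have a2 : 0 < - a / 2 by rewrite divr_gt0// oppr_gt0.
  have cP : {for y, continuous (fun t : V => Psi (t - z'))}.
    exact: continuous_subr Psi_cont _.
  have [d d0 dP] := (continuousP_enorm _ y).1 cP _ a2.
  apply/nbhs_enormP; exists d => // t /dP; rewrite Py subr0 => Pt tR.
  rewrite /g; case: ifPn => // tR'.
  rewrite ltr_pdivlMr ?Gpos//.
  have /andP[wt _] := w01 (Oz' _ tR').
  have : a * G t <= a * (1 / 2) by rewrite ler_nM2l// Ghalf.
  by move: Pt; rewrite ltr_norml => /andP[_]; lra.
have gx0 : g x0 < 0.
  apply: le_lt_trans (x0min x (ltW xR)) _.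
  by rewrite /g xR pmulr_llt0 ?subr_lt0// invr_gt0 Gpos// ltW.
have x0R' : enorm (x0 - z') < R0 by move: gx0; rewrite /g; case: ifP; rewrite ?ltxx.
have O0 := Oz' _ x0R'.
have G0 := Gpos _ x0R.
have gE y : enorm (y - z') < R0 -> g y * G y = w y - Psi (y - z').
  by move=> yR; rewrite /g yR divfK// gt_eqF// Gpos// ltW.
have x0r : rho0 < enorm (x0 - z').
  rewrite ltNge; apply/negP => /inner h.
  have : g x0 * G x0 < 0 by rewrite pmulr_llt0.
  by rewrite gE//; lra.
pose k := g x0 * (0 + b * (0 + -1 * (2 * N))).
have super : - f (Psi (x0 - z')) + k + f (w x0) <= 0.
  apply: (@w_super x0 (fun y => Psi (y - z') + g x0 * G y)
    (fun y => - f (Psi (y - z')) + k)) => //.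
  - by rewrite gE//; ring.
  - have r0 : 0 < R0 - enorm (x0 - z') by rewrite subr_gt0.
    apply/nbhs_enormP; exists (R0 - enorm (x0 - z')) => // y yx0.
    have yR : enorm (y - z') < R0 by have := enorm_triangle x0 y z'; lra.
    have [_ pc pL] := Psi_solution yR; split.
    + have : g x0 * G y <= g y * G y.
        by rewrite ler_pM2r; [apply: x0min; exact: ltW | apply: Gpos; exact: ltW].
      by rewrite gE//; lra.
    + apply: continuousD => //.
      by apply: continuousM; [exact: cst_continuous | exact: Gc].
    + by apply: haslapD pL _; apply: haslapZ.
  - apply: continuousD; last exact: cst_continuous.
    apply: continuousN.
    apply: (@continuous_comp _ _ _ (fun y : V => Psi (y - z')) f).
      exact: continuous_subr Psi_cont _.
    exact: f_cont.
(* The Lipschitz term is at most [C * - g x0], since [G <= 1] on the shell; the surplus [- g x0 > 0]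
   gives the contradiction. *)
have kE : k = - g x0 * (C + 1).
  by rewrite /k /b; field; rewrite gt_eqF.
have [/andP[P0 P1] _] := Psi_in x0R'.
have lip := f_lip (w01 O0) (_ : 0 <= Psi (x0 - z') <= 1).
have {lip} : `|f (w x0) - f (Psi (x0 - z'))| <= C * `|w x0 - Psi (x0 - z')|.
  by apply: lip; rewrite !ltW.
rewrite -gE// normrM (gtr0_norm G0) (ltr0_norm gx0) => lip.
have h1 : - g x0 * G x0 <= - g x0 * 1.
  by rewrite ler_pM2l ?oppr_gt0//; apply: Gle1; exact: ltW.
have h2 : C * (- g x0 * G x0) <= C * (- g x0 * 1) by rewrite ler_wpM2l.
have h3 : - g x0 * (C + 1) = C * (- g x0 * 1) - g x0 by ring.
move: super lip; rewrite kE h3 ler_norml => h4 /andP[h5 _].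
by lra.
Qed.

Lemma lies_above_path (gam : R -> V) :
  (forall s, 0 <= s <= 1 -> forall e, 0 < e -> exists2 d, 0 < d &
     forall t, 0 <= t <= 1 -> `|t - s| < d -> enorm (gam t - gam s) < e) ->
  (forall s, 0 <= s <= 1 -> ball_in_domain (gam s)) ->
  lies_above (gam 0) -> lies_above (gam 1).
Proof.
move=> gc gO g0.
apply: (@unit_interval_connected R (fun s => lies_above (gam s))) => //.
- move=> s s01 As; have [d d0 dP] := lies_above_open (gO _ s01) As.
  have [e e0 eP] := gc _ s01 _ d0.
  by exists e => // t t01 ts; apply: dP; [exact: gO | exact: eP].
- move=> s s01 cl; apply: lies_above_closed (gO _ s01) _ => d d0.
  have [e e0 eP] := gc _ s01 _ d0.
  have [t [t01 ts At]] := cl _ e0.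
  by exists (gam t); split => //; exact: eP.
- by rewrite ler01 lexx.
Qed.

Lemma lies_above_segment z z' :
  (forall s, 0 <= s <= 1 -> ball_in_domain (z + s *: (z' - z))) ->
  lies_above z -> lies_above z'.
Proof.
move=> Os az; have -> : z' = z + 1 *: (z' - z) by rewrite scale1r addrC subrK.
apply: (@lies_above_path (fun s => z + s *: (z' - z))) => //; last first.
  by rewrite scale0r addr0.
move=> s _ e e0; pose k := enorm (z' - z) + 1.
have k0 : 0 < k by rewrite ltr_wpDl// enorm_ge0.
exists (e / k) => [|t _ ts]; first exact: divr_gt0.
have -> : z + t *: (z' - z) - (z + s *: (z' - z)) = (t - s) *: (z' - z).
  by apply/rowP => i; rewrite !mxE; ring.
rewrite enormZ; apply: (@le_lt_trans _ _ (`|t - s| * k)).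
  by rewrite ler_wpM2l// lerDl.
by rewrite -ltr_pdivlMr.
Qed.

End Supersolution.

Lemma lipschitz_unit_interval {R : realType} (f : R -> R) :
  (forall x, derivable f x 1) -> continuous (derive1 f) ->
  exists2 C, 0 <= C & forall b c, 0 <= b <= 1 -> 0 <= c <= 1 ->
    `|f b - f c| <= C * `|b - c|.
Proof.
move=> df cf.
have cn : {within `[0, 1], continuous (fun x => `|derive1 f x|)}.
  apply: continuous_subspaceT => x.
  by apply: (@continuous_comp _ _ _ (derive1 f) Num.norm); [exact: cf | exact: norm_continuous].
have [m m01 mP] := EVT_max (@ler01 R) cn.
exists (`|derive1 f m|) => // b c.
wlog bc : b c / b <= c.
  move=> H b01 c01; have [bc|/ltW bc] := leP b c; first exact: H.
  by rewrite distrC (distrC b); exact: H.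
move=> /andP[b0 b1] /andP[c0 c1].
have [||k kI kE] := @MVT_segment R f (derive1 f) b c bc.
- by move=> x _; rewrite derive1E; exact/derivableP.
- apply: continuous_subspaceT => x.
  exact/differentiable_continuous/derivable1_diffP.
rewrite distrC kE normrM (distrC b) ler_wpM2r//.
move: kI; rewrite in_itv/= => /andP[bk kc].
by apply: mP; rewrite in_itv/=; apply/andP; split; lra.
Qed.

(** * From the classical hypotheses to the second-difference setting *)

Section EntireSolution.
Context {R : realType} {n : nat}.
Local Notation V := 'rV[R]_(n.+1).
Variables (f : R -> R) (K : set V) (rho : V -> R) (u : R -> V -> R).
Hypothesis K_closed : closed K.
Hypothesis u_entire : entire_solution f K rho u.

Lemma entire_solution_continuous t x : (~` K) x ->
  {for (t, x), continuous (fun p : R * V => u p.1 p.2)}.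
Proof.
move=> Ox; have [_ [uc _]] := u_entire.
have /subspace_continuousP/(_ (t, x)) := uc.
move=> /(_ (subset_closure Ox)) uc' P /uc' h.
have On : \forall p \near (t, x), (~` K) p.2.
  have : {for (t, x), continuous (fun p : R * V => p.2)} by exact: cvg_snd.
  apply; apply: open_nbhs_nbhs; split => //; exact: closed_openC.
have {}h : \forall p \near (t, x), closure (~` K) p.2 -> P (u p.1 p.2) := h.
suff : \forall p \near (t, x), P (u p.1 p.2) by [].
by apply: filterS2 h On => p hp Op; apply: hp; exact: subset_closure.
Qed.

Lemma entire_solution_parabolic : parabolic_solution f (~` K) u.
Proof.
move=> t x Ox; have [ud [_ [_ ueq]]] := u_entire.
have [dt [_ dx]] := ud t x Ox.
exists (laplacian (u t) x); last by rewrite -ueq//; exact/derivableP.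
apply: haslap_C2.
  have : nbhs x (~` K) by apply: open_nbhs_nbhs; split => //; exact: closed_openC.
  apply: filterS => y Oy i; have [_ [_ /(_ i)[]]] := ud t y Oy.
  by [].
by move=> i; have [_ [_ /(_ i)[]]] := dx i.
Qed.

End EntireSolution.

(** Extension by zero gives a globally continuous profile, so translates can be compared without
    tracking their domains. *)
Lemma ball_solution_extension {R : realType} {n : nat} (f : R -> R) (r : R) :
  ball_solvable n f r -> exists Psi : 'rV[R]_(n.+1) -> R,
  [/\ continuous Psi, forall x, r <= enorm x -> Psi x = 0 &
    forall x, enorm x < r -> 0 < Psi x < 1 /\ haslap Psi x (- f (Psi x))].
Proof.
move=> [P0 [Pin [Pout Pc]]].
pose Psi (x : 'rV[R]_(n.+1)) := if enorm x < r then P0 x else 0.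
have PE x : enorm x <= r -> Psi x = P0 x.
  rewrite /Psi le_eqVlt => /predU1P[xr|->//].
  by rewrite xr ltxx Pout.
have nball (x : 'rV[R]_(n.+1)) : enorm x < r -> \forall y \near x, enorm y < r.
  move=> xr; apply/nbhs_enormP; exists (r - enorm x); first by rewrite subr_gt0.
  by move=> y yx; have := enormD (y - x) x; rewrite subrK; lra.
have P0out (x : 'rV[R]_(n.+1)) : r <= enorm x -> Psi x = 0.
  by move=> rx; rewrite /Psi ltNge rx.
exists Psi; split => //.
- move=> x; apply/continuousP_enorm => e e0.
  have [xr|rx] := leP (enorm x) r; last first.
    exists (enorm x - r); first by rewrite subr_gt0.
    move=> y yx; have := enormD (x - y) y; rewrite subrK enormB => h.
    have yr : r < enorm y by lra.
    by rewrite !P0out ?subrr ?normr0// ltW.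
  have /subspace_continuousP/(_ x xr) := Pc.
  move=> /cvgrPdist_lt/(_ _ e0); rewrite /prop_near1 /within/= => /nbhs_enormP[d d0 dP].
  have dist y : enorm (y - x) < d -> enorm y <= r -> `|Psi y - Psi x| < e.
    by move=> yd yr; rewrite !PE// distrC; exact: dP.
  have [xr'|rx] := ltP (enorm x) r.
    have /nbhs_enormP[d' d'0 d'P] := nball _ xr'.
    exists (Num.min d d') => [|y]; first by rewrite lt_min d0.
    by rewrite lt_min => /andP[yd /d'P/ltW]; exact: dist.
  exists d => // y yd; have [yr|ry] := leP (enorm y) r; first exact: dist.
  by rewrite !P0out ?subrr ?normr0// ltW.
- move=> x xr; rewrite (PE _ (ltW xr)); have [C2 [eqn P01]] := Pin x xr.
  split => //.
  have -> : - f (P0 x) = laplacian P0 x.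
    by apply/eqP; rewrite eq_sym -addr_eq0; apply/eqP.
  apply: (@haslap_near _ _ P0).
    by apply: filterS (nball _ xr) => y yr; rewrite PE// ltW.
  apply: haslap_C2.
    by apply: filterS (nball _ xr) => y /Pin[C2y _] i; have [] := C2y i.
  by move=> i; have [_ [_ /(_ i)[]]] := C2 i.
Qed.

(** * Bounds on the maximum of the ball profile *)

Section BallProfile.
Context {R : realType} {n : nat}.
Local Notation V := 'rV[R]_(n.+1).
Variables (f : R -> R) (Psi : V -> R) (R0 : R).
Hypothesis R0_gt0 : 0 < R0.
Hypothesis Psi_cont : continuous Psi.
Hypothesis Psi_out : forall x, R0 <= enorm x -> Psi x = 0.
Hypothesis Psi_in : forall x, enorm x < R0 ->
  0 < Psi x < 1 /\ haslap Psi x (- f (Psi x)).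

(** The gap below 1 lets the profile fit under [u] at very negative times, where [u] is close to 1
    far to the left. *)
Lemma profile_max_lt1 : exists2 m, m < 1 & forall x, Psi x <= m.
Proof.
have [xm xmR xmP] : exists2 xm : V, enorm (xm - 0) <= R0 &
    (forall y, enorm (y - 0) <= R0 -> - Psi xm <= - Psi y).
  apply: (@compact_lsc_min R V [set y | enorm (y - 0) <= R0] (fun y => - Psi y)).
  - exact: compact_eball.
  - by exists 0; rewrite /= subrr enorm0 ltW.
  move=> x _ a aP; have d0 : 0 < - a - Psi x by lra.
  have /cvgrPdist_lt/(_ _ d0) := @Psi_cont x.
  by apply: filterS => y + _; rewrite ltr_norml; lra.
have P0 : 0 < Psi 0 by have [] := @Psi_in 0; rewrite ?enorm0// => /andP[].
have PM x : Psi x <= Psi xm.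
  have [xR|/ltW/Psi_out ->] := leP (enorm x) R0.
    by rewrite -lerN2; apply: xmP; rewrite subr0.
  apply: ltW; apply: lt_le_trans P0 _; rewrite -lerN2; apply: xmP.
  by rewrite subrr enorm0 ltW.
exists (Psi xm) => //; have [xR|/Psi_out ->] := ltP (enorm xm) R0.
  by have [/andP[]] := Psi_in xR.
exact: ltr01.
Qed.

(* Otherwise f(Psi) <= 0, so Psi is subharmonic and vanishes on the sphere. *)
Lemma profile_exceeds alpha : f alpha = 0 ->
  (forall s, 0 < s < alpha -> f s < 0) ->
  exists2 x, enorm x < R0 & alpha < Psi x.
Proof.
move=> fa fneg; apply: contrapT => no.
have Pa x : enorm x < R0 -> f (Psi x) <= 0.
  move=> xR; have [/andP[P0 _] _] := Psi_in xR.
  have : Psi x <= alpha by rewrite leNgt; apply/negP => h; apply: no; exists x.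
  rewrite le_eqVlt => /predU1P[->|Pl]; first by rewrite fa.
  by apply/ltW/fneg; rewrite P0.
have P0 : 0 < Psi 0 by have [] := @Psi_in 0; rewrite ?enorm0// => /andP[].
have R2 : 0 < R0 ^+ 2 by exact: exprn_gt0.
(* On the sphere [g] equals [- Psi 0 / 2], above its value [- Psi 0] at the origin, so the minimum
   is interior. The quadratic term makes the Laplacian of [g] strictly negative there. *)
pose d := Psi 0 / (2 * R0 ^+ 2).
have d0 : 0 < d by rewrite divr_gt0// mulr_gt0.
pose g (x : V) := - 1 * Psi x + - d * sqnorm (x - 0).
have gc x : {for x, continuous g}.
  apply: continuousD; apply: continuousM; try exact: cst_continuous.
    exact: Psi_cont.
  exact: continuous_subr continuous_sqnorm _.
have [xm xmR xmP] : exists2 xm : V, enorm (xm - 0) <= R0 &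
    (forall y, enorm (y - 0) <= R0 -> g xm <= g y).
  apply: (@compact_lsc_min R V [set y | enorm (y - 0) <= R0] g).
  - exact: compact_eball.
  - by exists 0; rewrite /= subrr enorm0 ltW.
  move=> x _ a aP; have e0 : 0 < g x - a by rewrite subr_gt0.
  have /cvgrPdist_lt/(_ _ e0) := gc x.
  by apply: filterS => y + _; rewrite ltr_norml; lra.
have xR : enorm xm < R0.
  rewrite ltNge; apply/negP => Rx.
  have := xmP 0; rewrite subrr enorm0 => /(_ (ltW R0_gt0)).
  rewrite subr0 in xmR.
  have xE : sqnorm xm = R0 ^+ 2.
    by rewrite -enorm_sqr; congr (_ ^+ 2); apply/eqP; rewrite eq_le xmR.
  rewrite /g Psi_out// !subr0 sqnorm0 xE.
  have -> : - d * R0 ^+ 2 = - (Psi 0 / 2) by rewrite /d; field; rewrite gt_eqF.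
  by lra.
have [_ PL] := Psi_in xR.
have := haslapD (haslapZ (k := -1) PL) (haslapZ (k := - d) (haslap_sqnorm xm 0)).
have xnear : \forall y \near xm, g xm <= g y.
  apply/nbhs_enormP; exists (R0 - enorm xm); first by rewrite subr_gt0.
  move=> y yx; apply: xmP; rewrite subr0.
  by have := enormD (y - xm) xm; rewrite subrK; lra.
move=> /(haslap_min xnear).
have N0 : 0 < d * (2 * n.+1%:R) by apply: mulr_gt0 d0 _; exact: mulr_gt0.
by have := Pa _ xR; lra.
Qed.

End BallProfile.

(** * Parabolic comparison on a ball: placing the first profile below [w] *)

Section BallComparison.
Context {R : realType} {n : nat}.
Local Notation V := 'rV[R]_(n.+1).
Variables (f : R -> R) (Om : set V) (u : R -> V -> R) (C : R).
Variables (Psi : V -> R) (R0 : R).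
Hypothesis u01 : forall t x, Om x -> 0 < u t x < 1.
Hypothesis u_cont : forall t x, Om x ->
  {for (t, x), continuous (fun p : R * V => u p.1 p.2)}.
Hypothesis u_sol : parabolic_solution f Om u.
Hypothesis f_lip : forall b c, 0 <= b <= 1 -> 0 <= c <= 1 ->
  `|f b - f c| <= C * `|b - c|.
Hypothesis Psi_cont : continuous Psi.
Hypothesis Psi_out : forall x, R0 <= enorm x -> Psi x = 0.
Hypothesis Psi_in : forall x, enorm x < R0 ->
  0 < Psi x < 1 /\ haslap Psi x (- f (Psi x)).

(** The weight $e^{-(C+1)(s-T)}$ dominates the Lipschitz constant: a negative minimum value $k$ of
    the difference would give $Ck\le(C+1)k$. The sphere is harmless because [Psi] vanishes there and
    [u] is positive. *)
Lemma ball_comparison z T : (forall x, enorm (x - z) <= R0 -> Om x) ->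
  (forall x, enorm (x - z) <= R0 -> Psi (x - z) < u T x) ->
  forall t x, T <= t -> enorm (x - z) <= R0 -> Psi (x - z) <= u t x.
Proof.
move=> BO uT t x Tt xz; rewrite leNgt; apply/negP => ux.
pose E (s : R) := expR (- (C + 1) * (s - T)).
have E0 s : 0 < E s by exact: expR_gt0.
pose g (p : R * V) := (u p.1 p.2 - Psi (p.2 - z)) * E p.1.
pose D := `[T, t]%classic `*` [set y : V | enorm (y - z) <= R0].
have DE (p : R * V) : D p <-> (T <= p.1 <= t) /\ enorm (p.2 - z) <= R0.
  by rewrite /D /setX/= in_itv.
have Dtx : D (t, x) by apply/DE; rewrite /= Tt lexx.
have [[ts xs] Ds smin] : exists2 p, D p & forall p', D p' -> g p <= g p'.
  apply: compact_lsc_min.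
  - by apply: compact_setX; [exact: segment_compact | exact: compact_eball].
  - by exists (t, x).
  move=> p /DE[_ pz] a ap.
  have c2 : {for p, continuous (fun p : R * V => p.2)} by exact: cvg_snd.
  have c1 : {for p, continuous (fun p : R * V => p.1)} by exact: cvg_fst.
  have gc : {for p, continuous g}.
    apply: continuousM.
      apply: continuousB.
        by have := @u_cont p.1 p.2 (BO _ pz); rewrite -surjective_pairing.
      apply: (@continuous_comp _ _ _ (fun p : R * V => p.2)
        (fun y : V => Psi (y - z))) => //.
      exact: continuous_subr Psi_cont _.
    apply: (@continuous_comp _ _ _
      (fun p : R * V => - (C + 1) * (p.1 - T)) expR).
      apply: continuousM; first exact: cst_continuous.
      by apply: continuousB => //; exact: cst_continuous.
    exact: continuous_expR.
  have /cvgrPdist_lt/(_ (g p - a)) := gc; rewrite subr_gt0 => /(_ ap).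
  by apply: filterS => p' + _; rewrite ltr_norml; lra.
have /DE[/= /andP[tsT tst] xsz] := Ds.
have neg : u ts xs - Psi (xs - z) < 0.
  have : g (ts, xs) < 0.
    by apply: le_lt_trans (smin _ Dtx) _; rewrite /g/= pmulr_llt0// subr_lt0.
  by rewrite /g/= pmulr_llt0.
have Ox := BO _ xsz.
have xsR : enorm (xs - z) < R0.
  rewrite ltNge; apply/negP => /Psi_out P0.
  by have /andP[] := u01 ts Ox; move: neg; rewrite P0; lra.
have Tts : T < ts.
  rewrite lt_neqAle tsT andbT; apply/eqP => Tts.
  by have := uT _ xsz; move: neg; rewrite -Tts; lra.
pose mu := (u ts xs - Psi (xs - z)) * E ts.
(* With its weight, [a] is the constant [mu], so [Psi (. - z) + a] touches [u] from below at the
   minimum point. *)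
pose a (s : R) := mu * expR ((C + 1) * (s - T)).
have aE s : a s * E s = mu.
  by rewrite /a /E -mulrA -expRD mulNr subrr expR0 mulr1.
have ats : a ts = u ts xs - Psi (xs - z).
  by apply: (mulIf (lt0r_neq0 (E0 ts))); rewrite aE.
have da : is_derive ts 1 a ((C + 1) * a ts).
  have dl : is_derive ts 1 (fun s : R => (C + 1) * (s - T)) (C + 1).
    by apply: is_derive_eq; rewrite /GRing.scale/=; ring.
  have de := @is_derive1_comp _ expR (fun s => (C + 1) * (s - T)) _ _ _
    (is_derive_expR _) dl.
  have dm := is_deriveZ mu de.
  by apply: is_derive_eq dm _; rewrite /GRing.scale/= /a; ring.
have [/andP[P0 P1] PL] := Psi_in xsR.
have := @parabolic_min R n f Om u u_sol a (fun y => Psi (y - z)) ts xs _ _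
  (ts - T) Ox _ da (haslap_shift PL).
rewrite subr_gt0 => /(_ Tts) H.
have {H} h : - f (Psi (xs - z)) + f (u ts xs) <= (C + 1) * a ts.
  apply: H.
    move=> s /andP[s1 s2]; rewrite ats.
    have : g (ts, xs) <= g (s, xs).
      by apply: smin; apply/DE; split => //=; apply/andP; split; lra.
    rewrite /g/= -/mu -(aE s) ler_pM2r//; lra.
  apply/nbhs_enormP; exists (R0 - enorm (xs - z)); first by rewrite subr_gt0.
  move=> y yx.
  have : g (ts, xs) <= g (ts, y).
    apply: smin; apply/DE; split => /=; first by rewrite tsT.
    by have := enorm_triangle xs y z; lra.
  by rewrite /g/= ler_pM2r.
have lip : `|f (u ts xs) - f (Psi (xs - z))| <= C * `|u ts xs - Psi (xs - z)|.
  apply: f_lip; last by rewrite !ltW.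
  by have /andP[/ltW -> /ltW ->] := u01 ts Ox.
move: lip h; rewrite (ltr0_norm neg) ats ler_norml => /andP[h1 _] h2.
move: neg h1 h2; move: (u ts xs - _) => k k0.
by rewrite mulrN opprK mulrDl mul1r; lra.
Qed.

Lemma lies_above_lower_limit z T : (forall x, enorm (x - z) <= R0 -> Om x) ->
  (forall x, enorm (x - z) <= R0 -> Psi (x - z) < u T x) ->
  lies_above (lower_limit Om u) Psi R0 z.
Proof.
move=> BO uT x xz; apply/ler_addgt0Pr => e e0; rewrite -lerBlDr.
apply: (lower_limit_ge u01); first by apply: BO; exact: ltW.
have cP : {for x, continuous (fun y : V => Psi (y - z))}.
  exact: continuous_subr Psi_cont _.
have [d d0 dP] := (continuousP_enorm _ x).1 cP _ e0.
exists (Num.min d (R0 - enorm (x - z))); first by rewrite lt_min d0 subr_gt0.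
exists T => t y Tt; rewrite lt_min => /andP[yd yR] _.
have yz : enorm (y - z) <= R0 by have := enorm_triangle x y z; lra.
have := ball_comparison BO uT Tt yz.
by have := dP _ yd; rewrite ltr_norml; lra.
Qed.

End BallComparison.

(** * From a lower bound above [alpha] on a half-space to the limit 1 *)

Section HalfSpace.
Context {R : realType} {n : nat}.
Local Notation V := 'rV[R]_(n.+1).
Variables (f : R -> R) (Om : set V) (w : V -> R) (alpha beta A0 : R).
Hypothesis w_lsc : forall x (b : R), Om x -> b < w x ->
  \forall y \near x, Om y -> b < w y.
Hypothesis w_super : supersolution f Om w.
Hypothesis f_cont : continuous f.
Hypothesis f_pos : forall s, alpha < s < 1 -> 0 < f s.
Hypothesis alpha_beta : alpha < beta.
Hypothesis half_space : forall x, A0 <= x1 x -> Om x /\ beta <= w x.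

(* On a ball of large radius r the minimum of w + d |x - z|^2 is interior,
   which forces f(w) <= 2 n d there. *)
Lemma half_space_limit (e : R) : 0 < e ->
  exists A, forall x, A <= x1 x -> 1 - e <= w x.
Proof.
move=> e0; have [be|be] := leP (1 - e) beta.
  by exists A0 => x /half_space[_]; exact: le_trans.
have fc : {within `[beta, 1 - e], continuous f}.
  by apply: continuous_subspaceT => s; exact: f_cont.
have [k /andP[k1 k2] kmin] : exists2 k : R, beta <= k <= 1 - e &
    (forall s : R, beta <= s <= 1 - e -> f k <= f s).
  have [k kI kmin] := EVT_min (ltW be) fc.
  by exists k => [|s sI]; [rewrite in_itv in kI | apply: kmin; rewrite in_itv].
have fk : 0 < f k.
  by apply: f_pos; rewrite (lt_le_trans alpha_beta k1)/=; lra.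
pose N : R := 2 * n.+1%:R.
have N0 : 0 < N by exact: mulr_gt0.
(* The Laplacian of $d|x-z|^2$ is then [f k / 2], strictly below the minimum of [f] on
   [[beta, 1 - e]]. *)
pose d := f k / (2 * N).
have N20 : 0 < 2 * N by exact: mulr_gt0.
have d0 : 0 < d by exact: divr_gt0.
have dN : d * N = f k / 2 by rewrite /d; field; rewrite gt_eqF.
(* Chosen so that [beta + d * r ^+ 2 > 1]: on the sphere the penalized function exceeds its value at
   [z], which is below [1 - e]. *)
pose r := 1 + d^-1 + `|beta|/d.
have r0 : 0 <= r by rewrite !addr_ge0// ?invr_ge0 ?divr_ge0// ltW.
have r1 : 1 <= r by rewrite /r -addrA lerDl addr_ge0// ?invr_ge0 ?divr_ge0// ltW.
have dr : 1 < beta + d * r ^+ 2.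
  have h1 : d * r <= d * r ^+ 2 by rewrite ler_pM2l// expr2 ler_peMl.
  have h2 : d * r = d + 1 + `|beta|.
    by rewrite /r; field; rewrite gt_eqF.
  by have := ler_norm (- beta); rewrite normrN; lra.
exists (A0 + r) => z Az; rewrite leNgt; apply/negP => wz.
have inhs y : enorm (y - z) <= r -> Om y /\ beta <= w y.
  move=> yr; apply: half_space.
  have := x1_le_enorm (y - z).
  have -> : x1 (y - z) = x1 y - x1 z by rewrite /x1 !mxE.
  by rewrite ler_norml; lra.
pose q (y : V) := - d * sqnorm (y - z).
have qc y : {for y, continuous q}.
  apply: continuousM; first exact: cst_continuous.
  exact: continuous_subr continuous_sqnorm _.
have [x0 x0r x0min] : exists2 x0 : V, enorm (x0 - z) <= r &
    (forall y, enorm (y - z) <= r -> w x0 - q x0 <= w y - q y).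
  apply: (@compact_lsc_min R V [set y | enorm (y - z) <= r] (fun y => w y - q y)).
  - exact: compact_eball.
  - by exists z; rewrite /= subrr enorm0.
  move=> y /= /inhs[Oy _] a aw.
  have [h1 h2] := midf_lt aw.
  have wy : (a + (w y - q y)) / 2 + q y < w y by lra.
  have e1 : 0 < (a + (w y - q y)) / 2 - a by lra.
  have /cvgrPdist_lt/(_ _ e1) := qc y.
  have OA : \forall t \near y, enorm (t - z) <= r -> Om t.
    by apply/nbhs_enormP; exists 1 => // t _ /inhs[].
  apply: filter_app; apply: filter_app OA; apply: filterS (w_lsc Oy wy).
  by move=> t h3 h4 + /h4/h3; rewrite ltr_norml; lra.
have [Ox0 bw0] := inhs _ x0r.
have qz : q z = 0 by rewrite /q subrr sqnorm0 mulr0.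
have h0 : w x0 - q x0 < 1 - e.
  have := x0min z; rewrite subrr enorm0 qz => /(_ r0); lra.
have q0 : q x0 <= 0 by rewrite /q mulNr oppr_le0 mulr_ge0 ?sqnorm_ge0// ltW.
have x0r' : enorm (x0 - z) < r.
  rewrite lt_neqAle x0r andbT; apply/eqP => x0E.
  by move: h0; rewrite /q -enorm_sqr x0E mulNr; lra.
have : - d * N + f (w x0) <= 0.
  apply: (@w_super x0 (fun y => q y + (w x0 - q x0)) (fun=> - d * N)) => //.
  - by rewrite addrC subrK.
  - apply/nbhs_enormP; exists (r - enorm (x0 - z)); first by rewrite subr_gt0.
    move=> y yx0; split.
    + have : enorm (y - z) <= r by have := enorm_triangle x0 y z; lra.
      by move=> /x0min; lra.
    + by apply: continuousD; [exact: qc | exact: cst_continuous].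
    + rewrite -[X in haslap _ _ X]addr0; apply: haslapD (haslap_cst _ _).
      by apply: haslapZ; exact: haslap_sqnorm.
  - exact: cst_continuous.
have : f k <= f (w x0) by apply: kmin; apply/andP; split; lra.
by rewrite mulNr dN; lra.
Qed.

End HalfSpace.

(** * Horizontal moves away from the wall, and the final assembly *)

Section OutsideWall.
Context {R : realType} {n : nat}.
Local Notation V := 'rV[R]_(n.+1).
Implicit Types (x z k : V) (K : set V).

Lemma far_ball_in_domain K (R0 : R) z : (forall k, K k -> R0 <= enorm (z - k)) ->
  ball_in_domain (~` K) R0 z.
Proof. by move=> far x xz /far; rewrite enormB leNgt xz. Qed.

Lemma enorm_shift_ge z (h : R) : 0 <= x1 z * h ->
  enorm z <= enorm (z + h *: evec R ord0).
Proof.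
move=> zh; apply: ler_wsqrtr; rewrite -/(sqnorm z) -/(sqnorm _) sqnorm_evec.
have -> : sqnorm z + 2 * z ord0 ord0 * h + h ^+ 2 =
  sqnorm z + (2 * (x1 z * h) + h ^+ 2) by rewrite /x1; ring.
by rewrite lerDl addr_ge0 ?sqr_ge0// mulr_ge0.
Qed.

(** When the displacement points away from every wall point in the first coordinate, no distance to
    the wall decreases. *)
Lemma far_shift K (R0 : R) z (h : R) : (forall k, K k -> R0 <= enorm (z - k)) ->
  (forall k, K k -> 0 <= (x1 z - x1 k) * h) ->
  ball_in_domain (~` K) R0 (z + h *: evec R ord0).
Proof.
move=> far side; apply: far_ball_in_domain => k Kk.
rewrite addrAC; apply: le_trans (far k Kk) _; apply: enorm_shift_ge.
by have := side k Kk; rewrite /x1 !mxE.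
Qed.

Lemma x1_shift z (h : R) : x1 (z + h *: evec R ord0) = x1 z + h.
Proof. by rewrite /x1 !mxE !eqxx mulr1. Qed.

Lemma x1B x z : x1 (x - z) = x1 x - x1 z.
Proof. by rewrite /x1 !mxE. Qed.

Lemma x1_segment z z' (s : R) : x1 (z + s *: (z' - z)) = x1 z + s * (x1 z' - x1 z).
Proof. by rewrite /x1 !mxE. Qed.

End OutsideWall.

Theorem theorem4p1 (R : realType) (n : nat) (hn : (1 <= n)%N)
  (f : R -> R) (alpha c : R) (phi : R -> R) (R0 : R)
  (M : R) (K : set 'rV[R]_(n.+1)) (rho : 'rV[R]_(n.+1) -> R)
  (u : R -> 'rV[R]_(n.+1) -> R) (v : 'rV[R]_(n.+1) -> R)
  (gamma : R -> 'rV[R]_(n.+1)) (P1 P2 : 'rV[R]_(n.+1)) :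
  bistable f alpha ->
  0 < c -> traveling_wave f alpha c phi ->
  is_R0 n f R0 ->
  wall M K rho ->
  (* u is the entire solution ubar *)
  entire_solution f K rho u ->
  (forall t x, closure (~` K) x -> 0 < u t x < 1) ->
  (forall e, 0 < e -> exists T : R, forall t x, t <= T -> (~` K) x ->
       `|u t x - phi (x1 x - c * t)| <= e) ->
  (* v is the limit profile vbar *)
  (forall x, (~` K) x -> u t x @[t --> +oo] --> v x) ->
  (* the curve gamma *)
  x1 P1 < 0 -> M < x1 P2 ->
  {within `[0, 1], continuous gamma} -> gamma 0 = P1 -> gamma 1 = P2 ->
  (forall s k, 0 <= s <= 1 -> K k -> R0 <= enorm (gamma s - k)) ->
  (* propagation: vbar(x_1, y) -> 1 as x_1 -> +oo (uniformly in y) *)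
  forall e, 0 < e -> exists A : R, forall x, (~` K) x -> A <= x1 x ->
    `|v x - 1| <= e.
Proof.
move=> [df [cf [_ [f0 [fa [_ [_ [_ [_ [fneg [fpos _]]]]]]]]]]] _.
move=> [_ [_ [_ [_ [phi1 _]]]]] [[R0_gt0 solv] _] [_ [Kcl [Kx1 _]]] ent u01cl.
move=> wavelim vlim P1n P2M gamc g0 g1 gK e e0.
have fc : continuous f.
  by move=> x; exact/differentiable_continuous/derivable1_diffP.
have [C C0 flip] := lipschitz_unit_interval df cf.
have [Psi [Pc Pout Pin]] := ball_solution_extension solv.
have Oo : open (~` K) by exact: closed_openC.
have u01 t x : (~` K) x -> 0 < u t x < 1.
  by move=> Ox; apply: u01cl; exact: subset_closure.
have uc := entire_solution_continuous Kcl ent.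
have us := entire_solution_parabolic Kcl ent.
pose w := lower_limit (~` K) u.
have w01 x : (~` K) x -> 0 <= w x <= 1.
  by move=> Ox; rewrite (lower_limit_ge0 u01 Ox) (lower_limit_le1 u01 Ox).
have wl : forall x (b : R), (~` K) x -> b < w x ->
    \forall y \near x, (~` K) y -> b < w y.
  by move=> x b; exact: (lower_limit_lsc u01).
have ws : supersolution f (~` K) w.
  by move=> x q L; exact: (lower_limit_supersolution Oo u01 uc us fc).
have slide := lies_above_segment Oo w01 wl ws fc f0 C0 flip R0_gt0 Pc Pout Pin.
have farP1 k : K k -> R0 <= enorm (P1 - k).
  by move=> Kk; rewrite -g0; apply: gK => //; rewrite lexx ler01.
have farP2 k : K k -> R0 <= enorm (P2 - k).
  by move=> Kk; rewrite -g1; apply: gK => //; rewrite lexx ler01.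
have [m m1 Pm] := profile_max_lt1 R0_gt0 Pc Pout Pin.
(* Two errors of size [e1] occur, [u] against the front and the front against 1. Together they stay
   below the gap [1 - m]. *)
pose e1 := (1 - m) / 3; have e10 : 0 < e1 by rewrite divr_gt0// subr_gt0.
have [Y YP] : exists Y : R, forall y : R, y < Y -> `|1 - phi y| < e1.
  by have /cvgrPdist_lt/(_ _ e10)[Y [_ YP]] := phi1; exists Y.
have [T TP] := wavelim _ e10.
(* A shift by [tau + 1] puts the closed ball about [zl] both to the left of the wall and where the
   front at time [T] is close to 1. *)
pose tau := R0 + `|c * T| + `|Y|.
have tau0 : 0 <= tau by rewrite !addr_ge0// ltW.
pose zl := P1 + (- tau - 1) *: evec R ord0.
have leftP x : enorm (x - zl) <= R0 -> x1 x < 0 /\ x1 x - c * T < Y.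
  move=> xz; have := x1_le_enorm (x - zl); rewrite x1B x1_shift ler_norml.
  move=> /andP[_ h]; have hT := ler_norm (- (c * T)); have hY := ler_norm (- Y).
  rewrite !normrN in hT hY; move: h; rewrite /tau => h.
  have nT : 0 <= `|c * T| by [].
  have nY : 0 <= `|Y| by [].
  by split; lra.
have abl : lies_above w Psi R0 zl.
  apply: (lies_above_lower_limit (T := T) u01 uc us flip Pc Pout Pin).
    by move=> x /leftP[x0 _] /Kx1/andP[]; rewrite leNgt x0.
  move=> x /leftP[x0 xY].
  have Ox : (~` K) x by move=> /Kx1/andP[]; rewrite leNgt x0.
  have := YP _ xY; have := TP T x (lexx T) Ox; have := Pm (x - zl).
  rewrite ltr_norml ler_norml => h1 /andP[h2 _] /andP[_ h3].
  by move: e10; rewrite /e1 in h2 h3 *; lra.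
have ab1 : lies_above w Psi R0 P1.
  apply: slide abl => s /andP[s0 s1].
  have -> : zl + s *: (P1 - zl) = P1 + ((1 - s) * (- tau - 1)) *: evec R ord0.
    by rewrite /zl; apply/rowP => i; rewrite !mxE; ring.
  apply: far_shift => // k Kk; have /andP[k0 _] := Kx1 _ Kk.
  apply: mulr_le0; first by lra.
  by apply: mulr_ge0_le0; lra.
have ab2 : lies_above w Psi R0 P2.
  rewrite -g1.
  apply: (lies_above_path Oo w01 wl ws fc f0 C0 flip R0_gt0 Pc Pout Pin); last first.
  - by rewrite g0.
  - by move=> s s01; apply: far_ball_in_domain => k; exact: gK.
  move=> s s01 d d0.
  have I01 (r : R) : `[0, 1]%classic r = (0 <= r <= 1) :> Prop.
    by rewrite /= in_itv.
  have s01' : `[0, 1]%classic s by rewrite I01.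
  have /subspace_continuousP/(_ s s01') gs := gamc.
  have /gs : nbhs (gamma s) [set y | enorm (y - gamma s) < d] by exact: near_enorm.
  move=> /nbhs_ballP[r /= r0 rP]; exists r => // t t01 ts.
  have t01' : `[0, 1]%classic t by rewrite I01.
  by apply: rP; [rewrite /ball/= distrC | exact: t01'].
(* Beyond [M + R0] every ball of radius [R0] misses the wall, and beyond [x1 P2] the horizontal move
   from [P2] goes to the right. The centre moves horizontally to [z'], then inside a hyperplane to
   [z]. *)
pose A1 := Num.max (M + R0) (x1 P2).
have abr z : A1 <= x1 z -> lies_above w Psi R0 z.
  rewrite ge_max => /andP[zM zP2].
  pose z' := P2 + (x1 z - x1 P2) *: evec R ord0.
  have z'x1 : x1 z' = x1 z by rewrite /z' x1_shift addrC subrK.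
  apply: (slide z').
    move=> s _ x xz; move=> /Kx1/andP[_]; apply/negP; rewrite -ltNge.
    have := x1_le_enorm (x - (z' + s *: (z - z'))).
    rewrite x1B x1_segment z'x1 subrr mulr0 addr0 ler_norml => /andP[h _].
    by lra.
  apply: slide ab2 => s /andP[s0 s1].
  have -> : P2 + s *: (z' - P2) = P2 + (s * (x1 z - x1 P2)) *: evec R ord0.
    by rewrite /z'; apply/rowP => i; rewrite !mxE; ring.
  apply: far_shift => // k Kk; have /andP[_ kM] := Kx1 _ Kk.
  by apply: mulr_ge0; [lra | apply: mulr_ge0; lra].
have [xm xmR xma] := profile_exceeds R0_gt0 Pc Pout Pin fa fneg.
(* Centring the profile at [x - xm] puts its point [xm], where it exceeds [alpha], at [x]. The extra
   [R0] covers the first coordinate of [xm]. *)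
have half x : A1 + R0 <= x1 x -> (~` K) x /\ Psi xm <= w x.
  move=> xA; have A1M : M + R0 <= A1 by rewrite le_max lexx.
  split; first by move=> /Kx1/andP[_]; apply/negP; rewrite -ltNge; lra.
  have -> : Psi xm = Psi (x - (x - xm)) by rewrite opprB addrC subrK.
  apply: abr; last by rewrite opprB addrC subrK.
  have := x1_le_enorm xm; rewrite x1B ler_norml => /andP[_ h].
  by lra.
have [A AP] := half_space_limit wl ws fc fpos xma half e0.
exists A => x Ox xA.
have wv : w x <= v x := lower_limit_le_cvg u01 Ox (vlim x Ox).
have v1 : v x <= 1.
  rewrite -(cvg_lim (@Rhausdorff R) (vlim x Ox)); apply: limr_le.
    exact: cvgP (vlim x Ox).
  by apply: nearW => t; have /andP[_ /ltW] := u01 t x Ox.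
have := AP x xA; rewrite ler_norml => h.
by apply/andP; split; lra.
Qed.
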